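(* The exponential map $\exp:\mathcal{L}_{G}\to G$ maps $\mathcal{L}_{Lie}$ homeomorphically onto $G_{f}(X)$.
   Context: Algebra. Let $\mathbb{C}\langle X_1,X_2,\dots\rangle$ be the associative algebra with unit $I$ of complex noncommutative polynomials in free noncommuting variables $X_1,X_2,\dots$. Let $\mathcal{A}\subset\mathbb{C}\langle X_1,X_2,\dots\rangle[[t]]$ be the subalgebra of formal power series of the form $$f=c_0I+\sum_{n=1}^{\infty}\Big(\sum_{i_1+\cdots+i_k=n}c_{i_1,\dots,i_k}X_{i_1}\cdots X_{i_k}\Big)t^n,\qquad c_0,c_{i_1,\dots,i_k}\in\mathbb{C},$$ where the inner sum is over all $k\ge1$ and all $(i_1,\dots,i_k)\in\mathbb{N}^k$ with sum $n$. Equip $\mathcal{A}$ with the weakest topology making all coefficient functions $f\mapsto c_0$, $f\mapsto c_{i_1,\dots,i_k}$ continuous. Let $G\subset\mathcal{A}$ be the topological group (under multiplication) of elements with $c_0=1$, and let $\mathcal{L}_G\subset\mathcal{A}$ be the Lie algebra of elements with $c_0=0$, with $[f,g]=fg-gf$. The map $\exp:\mathcal{L}_G\to G$ is $\exp(f)=e^f=\sum_{n\ge0}f^n/n!$. An element $g=\sum_{n\ge1}g_nt^n\in\mathcal{L}_G$ is a Lie element if each $g_n$ belongs to the free Lie algebra generated by $X_1,\dots,X_n$ (inside $\mathbb{C}\langle X_1,X_2,\dots\rangle$ with the commutator bracket). $\mathcal{L}_{Lie}\subset\mathcal{L}_G$ is the set of all Lie elements. Paths. Fix $T>0$, $I_T=[0,T]$.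 $X$ is the set of sequences $a=(a_1,a_2,\dots)$ of complex-valued functions $a_i\in L^\infty(I_T)$ with $\sup_{x\in I_T,\,i\in\mathbb{N}}|a_i(x)|^{1/i}<\infty$. For $a\in X$ let $F_a:I_T\to G$ be the solution (by Picard iteration, with coefficients Lipschitz in $x$) of $F'(x)=\big(\sum_{i\ge1}a_i(x)t^iX_i\big)F(x)$, $F_a(0)=I$, and set $E(a)=F_a(T)\in G$. The set $G(X):=E(X)$ is a subgroup of $G$ (the group of paths), and the group of formal paths $G_f(X)$ is the closure of $G(X)$ in $G$. (The paper defines $G(X)$ as a quotient of $X$ and $G_f(X)$ as its metric completion, and identifies them with these subgroups of $G$.) *)

(* Defs.v *)
From HB Require Import structures.
From mathcomp Require Import all_boot all_order all_algebra.
From mathcomp Require Import all_classical all_reals all_analysis.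
From mathcomp Require Import complex.

Set Implicit Arguments.
Unset Strict Implicit.
Unset Printing Implicit Defensive.

Import Order.TTheory GRing.Theory Num.Theory.
Import numFieldNormedType.Exports.

Local Open Scope classical_set_scope.
Local Open Scope ring_scope.

(** The letter [j : nat] stands for the variable X_(j+1), so the word
    [:: j_1; ..; j_k] stands for the monomial X_(j_1 + 1) ... X_(j_k + 1), whose
    weight (j_1 + 1) + ... + (j_k + 1) is the power of t attached to it. *)
Definition word := seq nat.

Definition weight (w : word) : nat := \sum_(j <- w) j.+1.

(** Since the power of t attached to a monomial is its weight, an element of the
    algebra A is the same thing as its family of coefficients, indexed by words.
    Under the same identification a noncommutative polynomial in the X_i's is a
    finitely supported family: X_i |-> X_i t^i is an injective morphism of
    algebras from C<X_1, X_2, ..> to A. *)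
Definition ncseries (K : Type) : Type := word -> K.

Section NCSeriesRing.
Variable K : comNzRingType.
Implicit Types f g h : ncseries K.

HB.instance Definition _ := GRing.Lmodule.copy (ncseries K) (word -> K^o).

Definition ncone : ncseries K := fun w => (w == [::])%:R.

Definition ncmul f g : ncseries K := fun w =>
  \sum_(k < (size w).+1) f (take k w) * g (drop k w).

Lemma ncmul_nil f g : ncmul f g [::] = f [::] * g [::].
Proof. by rewrite /ncmul big_ord_recl big_ord0 addr0. Qed.

Lemma ncmul_cons f g x w :
  ncmul f g (x :: w) = f [::] * g (x :: w) + ncmul (fun v => f (x :: v)) g w.
Proof. by rewrite /ncmul /= big_ord_recl. Qed.

Lemma ncmulDl : left_distributive ncmul +%R.
Proof.
move=> f g h; apply/funext => w; rewrite -[RHS]big_split /=.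
by apply: eq_bigr => k _; rewrite -mulrDl.
Qed.

Lemma ncmulDr : right_distributive ncmul +%R.
Proof.
move=> f g h; apply/funext => w; rewrite -[RHS]big_split /=.
by apply: eq_bigr => k _; rewrite -mulrDr.
Qed.

Lemma ncmulZl a f g : a *: ncmul f g = ncmul (a *: f) g.
Proof.
apply/funext => w; rewrite -[LHS]/(a * _) /ncmul big_distrr /=.
by apply: eq_bigr => k _; rewrite mulrA.
Qed.

Lemma ncmulZr a f g : a *: ncmul f g = ncmul f (a *: g).
Proof.
apply/funext => w; rewrite -[LHS]/(a * _) /ncmul big_distrr /=.
by apply: eq_bigr => k _; rewrite mulrCA.
Qed.

Lemma ncmulA : associative ncmul.
Proof.
move=> f g h; apply/funext => w; elim: w f g h => [|x w IHw] f g h.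
  by rewrite !ncmul_nil mulrA.
pose shift f : ncseries K := fun v => f (x :: v).
rewrite !ncmul_cons IHw ncmul_nil mulrDr mulrA -addrA; congr (_ + _).
have -> : (fun v => ncmul f g (x :: v)) =
    f [::] *: shift g + ncmul (shift f) g :> ncseries K.
  by apply/funext => v; rewrite ncmul_cons.
by rewrite ncmulDl -ncmulZl.
Qed.

Lemma ncmul1l : left_id ncone ncmul.
Proof.
move=> f; apply/funext => w; rewrite /ncmul big_ord_recl /= take0 drop0.
rewrite mul1r big1 ?addr0// => k _; rewrite /ncone.
by case: w k => [|x w] k; rewrite ?mul0r //; case: k.
Qed.

Lemma ncmul1r : right_id ncone ncmul.
Proof.
move=> f; apply/funext => w; rewrite /ncmul big_ord_recr /= take_size drop_size.
rewrite mulr1 big1 ?add0r// => k _; rewrite /ncone -size_eq0 size_drop.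
by rewrite subn_eq0 leqNgt ltn_ord mulr0.
Qed.

Lemma ncone_neq0 : ncone != 0.
Proof. by apply/eqP => /(congr1 (fun f => f [::])) /eqP; rewrite oner_eq0. Qed.

HB.instance Definition _ := GRing.Zmodule_isNzRing.Build (ncseries K)
  ncmulA ncmul1l ncmul1r ncmulDl ncmulDr ncone_neq0.
HB.instance Definition _ :=
  GRing.Lmodule_isLalgebra.Build K (ncseries K) ncmulZl.
HB.instance Definition _ :=
  GRing.Lalgebra_isAlgebra.Build K (ncseries K) ncmulZr.

Definition ncvar (j : nat) : ncseries K := fun w => (w == [:: j])%:R.

(** Coefficient of t^n. *)
Definition tcoef (n : nat) f : ncseries K :=
  fun w => if weight w == n then f w else 0.

Definition lie_bracket f g : ncseries K := f * g - g * f.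

Definition lie_subalgebra (S : set (ncseries K)) : Prop :=
  [/\ S 0, (forall (c : K) f g, S f -> S g -> S (c *: f + g))
    & (forall f g, S f -> S g -> S (lie_bracket f g))].

(** Lie algebra generated by X_1, .., X_n. *)
Definition lie_generated (n : nat) : set (ncseries K) :=
  smallest lie_subalgebra [set ncvar j | j in `I_n].

Definition grp_G : set (ncseries K) := [set f | f [::] = 1].

Definition lie_G : set (ncseries K) := [set f | f [::] = 0].

Definition lie_elements : set (ncseries K) :=
  [set g | lie_G g /\ forall n, (0 < n)%N -> lie_generated n (tcoef n g)].

End NCSeriesRing.

(** Topology of coefficientwise convergence. *)
HB.instance Definition _ (K : numFieldType) :=
  Uniform.copy (ncseries K) {ptws word -> K^o}.
HB.instance Definition _ (K : numFieldType) := Pointed.on (ncseries K).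

Definition ncexp (K : numFieldType) (f : ncseries K) : ncseries K :=
  limn (series (fun n => (n`!%:R)^-1 *: f ^+ n)).

Definition maps_homeomorphically (U V : topologicalType) (f : U -> V)
    (A : set U) (B : set V) : Prop :=
  [/\ set_bij A B f, {within A, continuous f} &
    exists g : V -> U,
      (forall x, A x -> g (f x) = x) /\ {within B, continuous g}].

Section Paths.
Variables (R : realType) (T : R).
Local Notation mu := (@lebesgue_measure R).

(** Elements of L^oo([0, T]) are given by representatives, only the values on
    [0, T] of which matter. *)
Definition Linfty (f : R -> R[i]) : Prop :=
  [/\ measurable_fun `[0, T] (fun x => complex.Re (f x)),
      measurable_fun `[0, T] (fun x => complex.Im (f x)) &
      exists M : R, {ae mu, forall x, x \in `[0, T] -> Normc.normc (f x) <= M}].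

(** [a j] is the function a_(j+1); the supremum is an essential one in x. *)
Definition paths : set (nat -> R -> R[i]) :=
  [set a | (forall j, Linfty (a j)) /\
    exists M : R, forall j, {ae mu, forall x, x \in `[0, T] ->
      Normc.normc (a j x) `^ (j.+1%:R^-1) <= M}].

(** The series sum_(i >= 1) c_i t^i X_i. *)
Definition ncletters (c : nat -> R[i]) : ncseries R[i] :=
  fun w => if w is [:: j] then c j else 0.

(** Solutions are meant in the sense of Caratheodory, and differentiation in the
    variable x is coefficientwise. The coefficients being complex valued
    functions of a real variable, they are differentiated through their real and
    imaginary parts. *)
Definition is_solution (a : nat -> R -> R[i]) (F : R -> ncseries R[i]) : Prop :=
  [/\ forall x, x \in `[0, T] -> grp_G (F x),
      F 0 = 1,
      forall w, [lipschitz complex.Re (F x w) | x in `[0, T]] /\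
                [lipschitz complex.Im (F x w) | x in `[0, T]]
    & {ae mu, forall x, x \in `]0, T[ -> forall w,
        is_derive x (1 : R) (fun y => complex.Re (F y w))
          (complex.Re ((ncletters (a ^~ x) * F x) w)) /\
        is_derive x (1 : R) (fun y => complex.Im (F y w))
          (complex.Im ((ncletters (a ^~ x) * F x) w))}].

Definition group_of_paths : set (ncseries R[i]) :=
  [set g | exists a F, [/\ paths a, is_solution a F & F T = g]].

(** Closure of the group of paths in the subspace G. *)
Definition group_of_formal_paths : set (ncseries R[i]) :=
  @grp_G R[i] `&` closure group_of_paths.

End Paths.

(* Main.v *)
(** For [f] without constant term each coefficient of [exp f] is a polynomial in
    the coefficients of [f], and [exp f - f] involves only coefficients of [f] on
    words of smaller weight; hence [exp] is a homeomorphism from L_G onto G, whose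
    inverse is found by a fixed-point iteration.

    [exp L_Lie] lies in the closure of the group of paths: the [f] in L_G such that
    [exp (c f)] is a limit of finite products of exponentials [exp (c_i X_j)] for
    all [c] form a closed Lie subalgebra (Trotter's formula for sums; for brackets,
    differentiate [s |-> exp (s f) g exp (- s f)]), and those products are endpoints
    of piecewise constant paths.

    Conversely, let [D] multiply the coefficient of each word by its weight. If
    [F' = A F], then [P = D(F) F^-1] satisfies [P' = D(A) + [A, P]], so by induction
    on the weight every linear functional vanishing on Lie polynomials of weight [n]
    is constant, hence zero, along [P]. So the weight [n] part of [D(g) g^-1] is Lie
    for [g] in the group of paths, and, the condition being closed, in its closure.
    If [g = exp f] and [f'] is the part of [f] of weight less than [n], assumed to be
    Lie, then the weight [n] parts of [D(g) g^-1] and [D(exp f') exp (- f')] are both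
    Lie, the latter by the first inclusion, and they differ by [n f_n]. *)

From HB Require Import structures.
Require Import Defs.
From mathcomp Require Import all_boot all_order all_algebra.
From mathcomp Require Import all_classical all_reals all_analysis.
From mathcomp Require Import complex ring lra.

Set Implicit Arguments.
Unset Strict Implicit.
Unset Printing Implicit Defensive.

Import Order.TTheory GRing.Theory Num.Theory.
Import numFieldNormedType.Exports.

Local Open Scope classical_set_scope.
Local Open Scope ring_scope.

(** * Words, their weights, and the algebra of series up to a given weight *)

Lemma weight_nil : weight [::] = 0%N.
Proof. by rewrite /weight big_nil. Qed.

Lemma weight_cons j w : weight (j :: w) = (j.+1 + weight w)%N.
Proof. by rewrite /weight big_cons. Qed.

Lemma weight_cat u v : weight (u ++ v) = (weight u + weight v)%N.
Proof. by rewrite /weight big_cat. Qed.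

Lemma weight_take_drop k w : weight w = (weight (take k w) + weight (drop k w))%N.
Proof. by rewrite -weight_cat cat_take_drop. Qed.

Lemma size_le_weight w : (size w <= weight w)%N.
Proof. by elim: w => // j w IH; rewrite weight_cons /= -addn1 addnC leq_add. Qed.

Section Algebra.
Variable K : comNzRingType.
Implicit Types (f g h : ncseries K) (w : word).

Lemma ncE0 w : (0 : ncseries K) w = 0. Proof. by []. Qed.
Lemma ncE1 w : (1 : ncseries K) w = (w == [::])%:R. Proof. by []. Qed.
Lemma ncED f g w : (f + g) w = f w + g w. Proof. by []. Qed.
Lemma ncEN f w : (- f) w = - f w. Proof. by []. Qed.
Lemma ncEZ c f w : (c *: f) w = c * f w. Proof. by []. Qed.
Lemma ncEM f g w :
  (f * g) w = \sum_(k < (size w).+1) f (take k w) * g (drop k w).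
Proof. by []. Qed.
Lemma ncEMnil f g : (f * g) [::] = f [::] * g [::].
Proof. exact: ncmul_nil. Qed.
Lemma ncEsum I (r : seq I) (P : pred I) (F : I -> ncseries K) w :
  (\sum_(i <- r | P i) F i) w = \sum_(i <- r | P i) F i w.
Proof. by elim/big_rec2: _ => // i x y _ <-. Qed.
Definition ncE := (ncED, ncEN, ncEZ, ncE0, ncE1, ncEsum).

Lemma ncext f g : f =1 g -> f = g. Proof. by move=> ?; apply/funext. Qed.

(** Congruence modulo [t^n]. *)
Definition agree n f g := forall w, (weight w < n)%N -> f w = g w.

Lemma agree_sub m n f g : (m <= n)%N -> agree n f g -> agree m f g.
Proof. by move=> mn fg w wm; apply: fg; apply: leq_trans mn. Qed.

Lemma agreeD n f f' g g' : agree n f f' -> agree n g g' ->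
  agree n (f + g) (f' + g').
Proof. by move=> ff gg w wn; rewrite !ncED ff ?gg. Qed.

Lemma agreeN n f f' : agree n f f' -> agree n (- f) (- f').
Proof. by move=> ff w wn; rewrite !ncEN ff. Qed.

Lemma agreeM n f f' g g' : agree n f f' -> agree n g g' ->
  agree n (f * g) (f' * g').
Proof.
move=> ff gg w wn; rewrite !ncEM; apply: eq_bigr => k _.
by rewrite ff ?gg //; apply: leq_ltn_trans wn; rewrite (weight_take_drop k w) ?leq_addl ?leq_addr.
Qed.

(** Without constant terms, only cuts of a word into two nonempty pieces contribute, and each piece
    weighs strictly less than the word. This gain of one weight makes the fixed-point maps below
    contract. *)
Lemma agreeM0 n f f' g g' : f [::] = 0 -> f' [::] = 0 -> g [::] = 0 ->
  g' [::] = 0 -> agree n f f' -> agree n g g' -> agree n.+1 (f * g) (f' * g').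
Proof.
move=> f0 f0' g0 g0' ff gg w; rewrite ltnS => wn; rewrite !ncEM.
apply: eq_bigr => k _; rewrite (weight_take_drop k w) in wn.
case: (take k w) (drop k w) wn => [|a u] [|b v] wn;
  rewrite ?f0 ?f0' ?g0 ?g0' ?mul0r ?mulr0//.
rewrite ff ?gg//; apply: leq_trans wn; rewrite !weight_cons.
  by rewrite -[X in (X < _)%N]add0n ltn_add2r.
by rewrite -[X in (X < _)%N]addn0 ltn_add2l.
Qed.

(** A word shorter than [n] cannot be cut into [n] nonempty pieces. *)
Lemma ncX_eq0 f n w : f [::] = 0 -> (size w < n)%N -> (f ^+ n) w = 0.
Proof.
move=> f0; elim: n w => [//|n IH] w wn; rewrite exprS ncEM big1 // => k _.
have [->|k0] := posnP k; first by rewrite take0 f0 mul0r.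
rewrite IH ?mulr0// size_drop; case: w k wn k0 => [|a w] [[|k] /= kw] //= wn _.
by rewrite subSS; apply: leq_ltn_trans (leq_subr _ _) _.
Qed.

(** In [(f * g) w] the cut at the end of [w] contributes [f w]; all other cuts evaluate [f] on
    shorter prefixes, where it vanishes by induction. *)
Lemma nc_rcancel f g : g [::] = 1 -> f * g = 0 -> f = 0.
Proof.
move=> g1 fg0; apply: ncext => w; have [n] := ubnP (size w).
elim: n w => // n IH w wn.
have /= := congr1 (@^~ w) fg0; rewrite ncEM big_ord_recr /= take_size drop_size.
rewrite g1 mulr1 big1 ?add0r// => -[k kw] _ /=.
by rewrite IH ?mul0r// size_take kw; apply: leq_trans kw _.
Qed.

(** The fixed point of [t] when [t] determines the coefficients of weight [n] from
    those of smaller weight. *)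
Definition ncfix (t : ncseries K -> ncseries K) : ncseries K :=
  fun w => iter (weight w).+1 t 0 w.

Lemma ncX_agree f g n k : agree n f g -> agree n (f ^+ k) (g ^+ k).
Proof. by move=> fg; elim: k => // k IH; rewrite !exprS; apply: agreeM. Qed.

Section FixedPoint.
Variable t : ncseries K -> ncseries K.
Hypothesis t_nil : forall f, f [::] = 0 -> t f [::] = 0.
Hypothesis t_contract : forall n f f', f [::] = 0 -> f' [::] = 0 ->
  agree n f f' -> agree n.+1 (t f) (t f').

Lemma iter_nil n : iter n t 0 [::] = 0.
Proof. by elim: n => // n; apply: t_nil. Qed.

(** Each iteration settles the coefficients of one more weight. *)
Lemma iter_agree m n : (m <= n)%N -> agree m (iter m t 0) (iter n t 0).
Proof.
elim: m n => [n _ w|m IH [//|n] mn]; first by rewrite ltn0.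
exact: t_contract (iter_nil m) (iter_nil n) (IH _ mn).
Qed.

Lemma ncfix_agree n : agree n (ncfix t) (iter n t 0).
Proof. by move=> w wn; apply: (iter_agree wn); exact: leqnn. Qed.

Lemma ncfix_nil : ncfix t [::] = 0.
Proof. exact: iter_nil. Qed.

Lemma ncfixE : t (ncfix t) = ncfix t.
Proof.
apply: ncext => w.
exact: t_contract ncfix_nil (iter_nil (weight w)) (@ncfix_agree _) w (leqnn _).
Qed.

Lemma fixpoint_unique f f' : f [::] = 0 -> f' [::] = 0 ->
  t f = f -> t f' = f' -> f = f'.
Proof.
move=> f0 f0' ft ft'; suff H n : agree n f f'.
  by apply: ncext => w; apply: H (leqnn _).
elim: n => [w|n IH]; first by rewrite ltn0.
by rewrite -ft -ft'; apply: t_contract.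
Qed.

End FixedPoint.

End Algebra.

(** * Coefficientwise convergence *)

Section Topology.
Variable K : numFieldType.
Implicit Types (f g h : ncseries K) (w : word).

(** The topology is the supremum of those pulled back along the coefficient maps; these are
    surjective, so [cvg_image] applies to each. *)
Lemma nc_cvgP (U : Type) (F : set_system U) {FF : Filter F} (u : U -> ncseries K)
    f :
  u @ F --> f <-> forall w, (fun i => u i w : K^o) @ F --> (f w : K^o).
Proof.
split.
  move=> uf w; apply: (@continuous_cvg _ _ _ _ _ _ (fun g : ncseries K => g w : K^o)) uf.
  exact: (@proj_continuous word (fun=> K^o) w).
move=> uf; apply/cvg_sup => w.
have wS : (fun g : word -> K^o => g w) @` setT = setT.
  by rewrite eqEsubset; split => // c _; exists (fun=> c).
apply/(cvg_image _ _ wS) => A /= /(uf w) FA.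
exists ((fun g : word -> K^o => g w) @^-1` A) => //.
by rewrite eqEsubset; split => [_ [g Ag <-]//|c Ac]; exists (fun=> c).
Qed.

Lemma fctsum_cvg (U I : Type) (F : set_system U) {FF : Filter F} (r : seq I)
    (P : pred I) (u : I -> U -> K^o) (a : I -> K^o) :
  (forall i, u i @ F --> a i) ->
  (fun x => \sum_(i <- r | P i) u i x) @ F --> \sum_(i <- r | P i) a i.
Proof.
move=> ua; elim: r => [|i r IH].
  by under eq_fun do rewrite big_nil; rewrite big_nil; apply: cvg_cst.
under eq_fun do rewrite big_cons; rewrite big_cons.
by case: (P i) => //; apply: cvgD.
Qed.

Lemma nc_cvgD (U : Type) (F : set_system U) {FF : Filter F}
    (u v : U -> ncseries K) f g :
  u @ F --> f -> v @ F --> g -> (fun i => u i + v i) @ F --> f + g.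
Proof.
move=> /nc_cvgP uf /nc_cvgP vg; apply/nc_cvgP => w.
exact: (@cvgD K K^o _ _ _ _ _ _ _ (uf w) (vg w)).
Qed.

Lemma nc_cvgN (U : Type) (F : set_system U) {FF : Filter F}
    (u : U -> ncseries K) f :
  u @ F --> f -> (fun i => - u i) @ F --> - f.
Proof.
move=> /nc_cvgP uf; apply/nc_cvgP => w.
exact: (@cvgN K K^o _ _ _ _ _ (uf w)).
Qed.

Lemma nc_cvgM (U : Type) (F : set_system U) {FF : Filter F}
    (u v : U -> ncseries K) f g :
  u @ F --> f -> v @ F --> g -> (fun i => u i * v i) @ F --> f * g.
Proof.
move=> /nc_cvgP uf /nc_cvgP vg; apply/nc_cvgP => w.
apply: fctsum_cvg => k.
exact: (@cvgM K _ _ _ _ _ _ _ (uf _) (vg _)).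
Qed.

Lemma nc_cvgZ (U : Type) (F : set_system U) {FF : Filter F} (c : U -> K^o) a
    (u : U -> ncseries K) f :
  c @ F --> (a : K^o) -> u @ F --> f -> (fun i => c i *: u i) @ F --> a *: f.
Proof.
move=> ca /nc_cvgP uf; apply/nc_cvgP => w.
exact: (@cvgM K _ _ _ _ _ _ _ ca (uf _)).
Qed.

Lemma nc_cvgX (U : Type) (F : set_system U) {FF : Filter F}
    (u : U -> ncseries K) f n :
  u @ F --> f -> (fun i => u i ^+ n) @ F --> f ^+ n.
Proof.
move=> uf; elim: n => [|n IH]; first exact: cvg_cst.
by under eq_fun do rewrite exprS; rewrite exprS; apply: nc_cvgM.
Qed.

(** Each coefficient of the fixed point is a coefficient of a finite iterate, so continuity of the
    iterates is enough. *)
Lemma ncfix_continuous (t : ncseries K -> ncseries K -> ncseries K) :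
  (forall g n, (fun g => iter n (t g) 0) @ g --> iter n (t g) 0) ->
  continuous (fun g => ncfix (t g)).
Proof.
move=> tc g; have FF := nbhs_filter g.
apply/(nc_cvgP (fun g => ncfix (t g)) (ncfix (t g))) => w.
exact: ((nc_cvgP _ _).1 (tc g _) w).
Qed.

Lemma nc_hausdorff : hausdorff_space (ncseries K).
Proof. by apply: (@hausdorff_product _ (fun=> K^o)) => _; apply: norm_hausdorff. Qed.

End Topology.

(** * Exponential and logarithm *)

Section PowerSeries.
Variable K : numFieldType.
Implicit Types (c : nat -> K) (f g h : ncseries K) (w : word).

(** The power series [sum_k c_k f^k]: only the powers up to the length of a word
    contribute to its coefficient when [f [::] = 0]. *)
Definition pser c f : ncseries K :=
  fun w => \sum_(k < (size w).+1) c k * (f ^+ k) w.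

Lemma pserE c f n w : f [::] = 0 -> (size w < n)%N ->
  pser c f w = (\sum_(k < n) c k *: f ^+ k) w.
Proof.
move=> f0 wn; rewrite ncEsum /pser (big_ord_widen n (fun k => c k * (f ^+ k) w)) //.
rewrite big_mkcond /=; apply: eq_bigr => k _; rewrite ncEZ.
by case: ltnP => // kw; rewrite ncX_eq0 ?mulr0.
Qed.

Lemma pser_agree c f n : f [::] = 0 ->
  agree n (pser c f) (\sum_(k < n) c k *: f ^+ k).
Proof. by move=> f0 w wn; apply: pserE => //; apply: leq_ltn_trans (size_le_weight w) wn. Qed.

Lemma pser_congr c f g n : agree n f g -> agree n (pser c f) (pser c g).
Proof. by move=> fg w wn; apply: eq_bigr => k _; rewrite (ncX_agree _ fg). Qed.

Lemma pser_nil c f : pser c f [::] = c 0.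
Proof. by rewrite /pser big_ord1 expr0 mulr1. Qed.

Lemma pserS c f : f [::] = 0 ->
  pser c f = (c 0)%:A + f * pser (c \o succn) f.
Proof.
move=> f0; apply: ncext => w; set n := weight w.
rewrite (@pser_agree c f n.+1)// big_ord_recl expr0 !ncED; congr (_ + _).
have -> : (f * pser (c \o succn) f) w =
    (f * \sum_(k < n.+1) (c \o succn) k *: f ^+ k) w.
  by apply: (@agreeM _ n.+1) => //; exact: pser_agree.
(* The last term is a multiple of [f ^+ n.+1], which vanishes at [w] because the length of [w] is at
   most its weight [n]. *)
rewrite big_ord_recr /= mulrDr mulr_sumr ncED [X in _ = _ + X](_ : _ = 0).
  rewrite addr0 !ncEsum; apply: eq_bigr => k _.
  by rewrite -scalerAr -exprS.
by rewrite -scalerAr -exprS ncEZ ncX_eq0 ?mulr0// ltnS size_le_weight.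
Qed.

Lemma pser_cvg (U : Type) (F : set_system U) {FF : Filter F} c
    (u : U -> ncseries K) f :
  u @ F --> f -> (fun i => pser c (u i)) @ F --> pser c f.
Proof.
move=> uf; apply/nc_cvgP => w; apply: fctsum_cvg => k.
apply: (@cvgM K); first exact: cvg_cst.
exact: (nc_cvgP (fun i => u i ^+ k) (f ^+ k)).1 (nc_cvgX (n := k) uf) w.
Qed.

Definition expc (k : nat) : K := (k`!%:R)^-1.

Definition pexp f := pser expc f.

Lemma pexp_nil f : pexp f [::] = 1.
Proof. by rewrite /pexp pser_nil /expc fact0 invr1. Qed.

Lemma pexp0 : pexp 0 = 1.
Proof. by rewrite /pexp pserS// mul0r addr0 /expc fact0 invr1 scale1r. Qed.

Lemma ncexpE f : f [::] = 0 -> ncexp f = pexp f.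
Proof.
move=> f0; apply: (cvg_lim (@nc_hausdorff K)); apply/nc_cvgP => w.
apply: cvg_near_cst; near=> n.
rewrite [RHS](@pserE expc f n) //; first by rewrite seriesEord.
by near: n; exists (size w).+1.
Unshelve. all: by end_near. Qed.

(** Its fixed points are the logarithms of [g]. *)
Definition logstep g f := g - pexp f + f.

(** The remainder [exp f - f - 1] is displayed as a product of two series without constant term, the
    form to which [agreeM0] applies. *)
Lemma pexpB f : f [::] = 0 ->
  pexp f - f = 1 + f * (f * pser (expc \o succn \o succn) f).
Proof.
move=> f0; rewrite /pexp pserS// pserS// /expc /= fact0 invr1 !scale1r.
by rewrite mulrDr mulr1 [X in X - f]addrCA [LHS]addrC addKr.
Qed.

Lemma pexpB_agree n f f' : f [::] = 0 -> f' [::] = 0 ->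
  agree n f f' -> agree n.+1 (pexp f - f) (pexp f' - f').
Proof.
move=> f0 f0' ff; rewrite !pexpB//; apply: agreeD => //.
apply: agreeM0 => //; try by rewrite ncEMnil ?f0 ?f0' mul0r.
by apply: agreeM => //; exact: pser_congr.
Qed.

Lemma logstep_contract g n f f' : f [::] = 0 -> f' [::] = 0 ->
  agree n f f' -> agree n.+1 (logstep g f) (logstep g f').
Proof.
move=> f0 f0' ff.
have E h : logstep g h = g - (pexp h - h) by rewrite opprB addrA addrAC.
by rewrite !E; apply: agreeD => //; apply/agreeN/pexpB_agree.
Qed.

Definition nclog g : ncseries K := ncfix (logstep g).

Lemma logstep_nil g f : g [::] = 1 -> f [::] = 0 -> logstep g f [::] = 0.
Proof. by move=> g1 f0; rewrite /logstep !ncE g1 pexp_nil f0 subrr addr0. Qed.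

Lemma nclog_nil g : g [::] = 1 -> nclog g [::] = 0.
Proof. by move=> g1; apply: ncfix_nil => f; exact: logstep_nil. Qed.

Lemma logstep_fix g f : (logstep g f = f) <-> (pexp f = g).
Proof.
split=> [/eqP|<-]; last by rewrite /logstep subrr add0r.
by rewrite /logstep -subr_eq0 addrK subr_eq0 => /eqP.
Qed.

Lemma nclogK g : g [::] = 1 -> pexp (nclog g) = g.
Proof.
move=> g1; apply/logstep_fix; apply: ncfixE => [f|]; first exact: logstep_nil.
exact: logstep_contract.
Qed.

Lemma pexp_inj f f' : f [::] = 0 -> f' [::] = 0 -> pexp f = pexp f' -> f = f'.
Proof.
move=> f0 f0' E; apply: (fixpoint_unique (t := logstep (pexp f'))) => //.
- exact: logstep_contract.
- exact/logstep_fix.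
- exact/logstep_fix.
Qed.

Lemma pexpK f : f [::] = 0 -> nclog (pexp f) = f.
Proof.
move=> f0; have p0 := pexp_nil f.
by apply: pexp_inj => //; [exact: nclog_nil|exact: nclogK].
Qed.

Lemma pexp_continuous : continuous pexp.
Proof. by move=> f; apply: (@pser_cvg _ (nbhs f) _ expc id). Qed.

Lemma nclog_continuous : continuous nclog.
Proof.
apply: ncfix_continuous => g n; have FF := nbhs_filter g.
elim: n => [|n IH]; first exact: cvg_cst.
apply: nc_cvgD => //; apply: nc_cvgD => //; apply: nc_cvgN.
exact: pser_cvg.
Qed.

End PowerSeries.

(** * Limits of powers with growing exponent, and Trotter's formula *)

Lemma cvg_to_eq (T : topologicalType) (U : Type) (F : set_system U) (u : U -> T)
    (a b : T) : a = b -> u @ F --> a -> u @ F --> b.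
Proof. by move->. Qed.

(** A general [numFieldType] may fail to be archimedean, so the next sections take this limit as a
    hypothesis; here it is checked for [R[i]]. *)
Lemma natr_inv_cvg (R : realType) :
  (fun n : nat => (n%:R : R[i])^-1 : R[i]^o) @ \oo --> (0 : R[i]^o).
Proof.
apply/cvgrPdist_lt => e e0.
(* A positive number of [R[i]] is real, so the archimedean property of [R] can be applied to the
   real part of [e^-1]. *)
have /andP[/eqP Ie Re] : (complex.Im e^-1 == 0) && (0 < complex.Re e^-1).
  by have : 0 < e^-1; [rewrite invr_gt0|rewrite ltcE /= eq_sym].
near=> n.
rewrite sub0r normrN normfV normr_nat.
have n0 : (0 < n)%N by near: n; exists 1%N.
rewrite -[e]invrK ltf_pV2 ?posrE ?invr_gt0 ?ltr0n//.
rewrite ltcE Ie raddfMn /= mul0rn eqxx /= raddfMn /=.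
near: n; exists (Num.bound (complex.Re e^-1)) => //= n /= bn.
apply: lt_le_trans (archi_boundP (ltW Re)) _.
by rewrite ler_nat.
Unshelve. all: by end_near. Qed.

Section Limits.
Variable K : numFieldType.
Implicit Types (f g h : ncseries K) (w : word).
Hypothesis natr_inv : (fun n : nat => (n%:R : K)^-1 : K^o) @ \oo --> (0 : K^o).

(** The falling factorial divided by [n ^+ k] is the product of the [1 - i / n] for [i < k], which
    tends to [1]. *)
Lemma bin_cvg k :
  (fun n : nat => 'C(n, k)%:R / n%:R ^+ k : K^o) @ \oo --> (expc K k : K^o).
Proof.
have H : (fun n : nat => (n ^_ k)%:R / n%:R ^+ k : K^o) @ \oo --> (1 : K^o).
  elim: k => [|k IH].
    by under eq_fun do rewrite ffactn0 expr0 divr1; apply: cvg_cst.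
  apply: (@cvg_trans _ ((fun n : nat => ((n ^_ k)%:R / n%:R ^+ k) *
      (1 - k%:R / n%:R) : K^o) @ \oo)).
    apply: near_eq_cvg; near=> n.
    have nk : (k < n)%N by near: n; exists k.+1.
    have n0 : (n%:R : K) != 0 by rewrite pnatr_eq0; case: (n) nk.
    rewrite ffactnSr natrM (natrB _ (ltnW nk)) exprSr -mulf_div.
    by rewrite mulrBl divff.
  apply: (cvg_to_eq (T := K^o) (mulr1 1)); apply: (@cvgM K) => //.
  apply: (cvg_to_eq (T := K^o) (subr0 1)); apply: (@cvgB K K^o); first exact: cvg_cst.
  apply: (cvg_to_eq (T := K^o) (mulr0 (k%:R : K))).
  by apply: (@cvgM K) => //; exact: cvg_cst.
have -> : (fun n : nat => 'C(n, k)%:R / n%:R ^+ k : K^o) =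
    fun n => ((n ^_ k)%:R / n%:R ^+ k) * expc K k.
  apply/funext => n; rewrite -bin_ffact natrM /expc [RHS]mulrAC mulfK// pnatr_eq0 -lt0n fact_gt0.
apply: (cvg_to_eq (T := K^o) (mul1r (expc K k))); apply: (@cvgM K) => //; exact: cvg_cst.
Unshelve. all: by end_near. Qed.

(** At a given word only the binomial terms with [k] up to its length survive, so the limit is taken
    in a sum with a fixed number of terms. *)
Lemma pow_cvg (y : nat -> ncseries K) f : (forall n, y n [::] = 0) ->
  (fun n => n%:R *: y n) @ \oo --> f ->
  (fun n => (1 + y n) ^+ n) @ \oo --> pexp f.
Proof.
move=> y0 yf; apply/nc_cvgP => w.
pose u n : K^o := \sum_(k < (size w).+1)
  ('C(n, k)%:R / n%:R ^+ k) * ((n%:R *: y n) ^+ k) w.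
apply: (@cvg_trans _ (u @ \oo)); last first.
  apply: fctsum_cvg => k; apply: (@cvgM K); first exact: bin_cvg.
  exact: (nc_cvgP (fun i => _ i ^+ k) (f ^+ k)).1 (nc_cvgX (n := k) yf) w.
apply: near_eq_cvg; near=> n.
have nw : (size w < n)%N by near: n; exists (size w).+1.
have n0 : (n%:R : K) != 0 by rewrite pnatr_eq0; case: (n) nw.
pose F k := ('C(n, k)%:R / n%:R ^+ k) * ((n%:R *: y n) ^+ k) w.
rewrite /u addrC exprD1n ncEsum (big_ord_widen n.+1 F) ?ltnS 1?ltnW//.
rewrite big_mkcond; apply: eq_bigr => k _ /=.
rewrite -scaler_nat ncEZ; case: ltnP => kw; last by rewrite ncX_eq0 ?mulr0.
by rewrite /F exprZn ncEZ mulrA divfK // expf_neq0.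
Unshelve. all: by end_near. Qed.

(** [(1 + f/n)(1 + g/n) = 1 + (f + g + fg/n)/n] has [n]-th powers converging to both
    sides. *)
Lemma pexpD f g : f [::] = 0 -> g [::] = 0 -> f * g = g * f ->
  pexp (f + g) = pexp f * pexp g.
Proof.
move=> f0 g0 fg.
(* For [n = 0] the inverse is [0] by convention, so the two sequences are compared only
   eventually. *)
have scale_cvg h (v : nat -> ncseries K) : v @ \oo --> h ->
    (fun n : nat => n%:R *: (n%:R^-1 *: v n)) @ \oo --> h.
  move=> vh; apply: cvg_trans vh; apply: near_eq_cvg; near=> n.
  rewrite scalerA divff ?scale1r// pnatr_eq0 -lt0n.
  by near: n; exists 1%N.
have L h : h [::] = 0 -> (fun n => (1 + n%:R^-1 *: h) ^+ n) @ \oo --> pexp h.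
  move=> h0; apply: pow_cvg => [n|]; first by rewrite ncEZ h0 mulr0.
  exact: scale_cvg (cvg_cst _).
have R : (fun n => (1 + n%:R^-1 *: (f + g + n%:R^-1 *: (f * g))) ^+ n) @ \oo -->
    pexp (f + g).
  apply: pow_cvg => [n|]; first by rewrite !ncE ncEMnil f0 g0 !(mulr0, addr0).
  apply: scale_cvg; apply: (cvg_to_eq (addr0 _)).
  apply: nc_cvgD; first exact: cvg_cst.
  by rewrite -(scale0r (f * g)); apply: nc_cvgZ => //; exact: cvg_cst.
apply: (cvg_unique (@nc_hausdorff K) R).
apply: cvg_trans (nc_cvgM (L f f0) (L g g0)).
apply: near_eq_cvg; near=> n; rewrite -exprMn_comm; first congr (_ ^+ _).
  rewrite mulrDl mul1r mulrDr mulr1 -!scalerAl -!scalerAr !scalerDr !addrA.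
  by rewrite [1 + _ + _ in RHS]addrAC.
rewrite /GRing.comm !mulrDl !mulrDr !mul1r !mulr1 -!scalerAl -!scalerAr fg.
by rewrite !addrA; congr (_ + _); rewrite addrAC.
Unshelve. all: by end_near. Qed.

Lemma pexpVK f : f [::] = 0 -> pexp (- f) * pexp f = 1.
Proof.
move=> f0; rewrite -pexpD ?addNr ?pexp0 ?ncEN ?f0 ?oppr0//.
by rewrite mulNr mulrN.
Qed.

Lemma pexpKV f : f [::] = 0 -> pexp f * pexp (- f) = 1.
Proof. by move=> f0; rewrite -{1}[f]opprK pexpVK ?ncEN ?f0 ?oppr0. Qed.

(** The derivative of [exp (s f)] at [s = 0], along [s = 1 / n]: [exp (f / n) - 1] is [f / n] times
    a power series in [f / n] that tends to [1]. *)
Lemma pexp_deriv0 f : f [::] = 0 ->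
  (fun n : nat => n%:R *: (pexp (n%:R^-1 *: f) - 1)) @ \oo --> f.
Proof.
move=> f0; have E : f * pser (expc K \o succn) 0 = f.
  by rewrite pserS// mul0r addr0 /= /expc invr1 scale1r mulr1.
apply: (cvg_to_eq (T := ncseries K) E).
apply: (@cvg_trans _ ((fun n : nat => f * pser (expc K \o succn) (n%:R^-1 *: f)) @ \oo)).
  apply: near_eq_cvg; near=> n.
  rewrite /pexp [pser (expc K) _]pserS; last by rewrite ncEZ f0 mulr0.
  rewrite [expc K 0]invr1 scale1r [X in X - 1]addrC addrK -scalerAl scalerA divff ?scale1r//.
  by rewrite pnatr_eq0 -lt0n; near: n; exists 1%N.
apply: nc_cvgM; first exact: cvg_cst.
apply: pser_cvg; rewrite -(scale0r f); apply: nc_cvgZ => //; exact: cvg_cst.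
Unshelve. all: by end_near. Qed.

(** The product of the two exponentials has the form [1 + y n] where [n * y n] tends to [f + g], so
    [pow_cvg] applies. *)
Lemma trotter f g : f [::] = 0 -> g [::] = 0 ->
  (fun n : nat => (pexp (n%:R^-1 *: f) * pexp (n%:R^-1 *: g)) ^+ n) @ \oo -->
    pexp (f + g).
Proof.
move=> f0 g0.
have -> : (fun n : nat => (pexp (n%:R^-1 *: f) * pexp (n%:R^-1 *: g)) ^+ n) =
  fun n : nat => (1 + (pexp (n%:R^-1 *: f) * pexp (n%:R^-1 *: g) - 1)) ^+ n.
  by apply/funext => n; rewrite addrC subrK.
apply: pow_cvg => [n|].
  by rewrite !ncE ncEMnil !pexp_nil mulr1 eqxx subrr.
apply: (@cvg_trans _ ((fun n : nat =>
    n%:R *: (pexp (n%:R^-1 *: f) - 1) * pexp (n%:R^-1 *: g)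
     + n%:R *: (pexp (n%:R^-1 *: g) - 1)) @ \oo)).
  apply: near_eq_cvg; apply: nearW => n.
  by rewrite -scalerAl mulrBl mul1r -scalerDr addrA subrK.
apply: nc_cvgD; last exact: pexp_deriv0.
apply: (cvg_to_eq (T := ncseries K) (mulr1 f)); apply: nc_cvgM; first exact: pexp_deriv0.
rewrite -(pexp0 K); apply: pser_cvg.
by rewrite -(scale0r g); apply: nc_cvgZ => //; exact: cvg_cst.
Qed.

End Limits.

(** * Limits of products of exponentials *)

Section Conj.
Variable K : numFieldType.
Implicit Types (f g u v : ncseries K).

Lemma exprJ u v g k : u * v = 1 -> v * u = 1 -> (u * g * v) ^+ k = u * g ^+ k * v.
Proof.
move=> uv vu; elim: k => [|k IH]; first by rewrite !expr0 mulr1.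
by rewrite exprS IH !mulrA -(mulrA (u * g)) vu mulr1 exprS !mulrA.
Qed.

Lemma pexpJ u v g : u * v = 1 -> v * u = 1 -> g [::] = 0 ->
  pexp (u * g * v) = u * pexp g * v.
Proof.
move=> uv vu g0; have c0 : (u * g * v) [::] = 0 by rewrite !ncEMnil g0 mulr0 mul0r.
apply: ncext => w; rewrite [LHS](@pser_agree _ _ _ (weight w).+1)//.
transitivity ((u * (\sum_(k < (weight w).+1) expc K k *: g ^+ k) * v) w).
  rewrite mulr_sumr mulr_suml !ncEsum; apply: eq_bigr => k _.
  by rewrite exprJ// -scalerAr -scalerAl.
apply: (@agreeM _ (weight w).+1) => //; apply: agreeM => // x xw.
by rewrite [RHS](@pser_agree _ _ _ (weight w).+1).
Qed.

Lemma tcoef0 f : f [::] = 0 -> tcoef 0 f = 0.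
Proof.
move=> f0; apply: ncext => w; rewrite /tcoef; case: eqP => // w0.
by case: w w0 => // j w; rewrite weight_cons.
Qed.

(** At each word a single [n], its weight, contributes, so the partial sums are eventually constant
    there. *)
Lemma tcoef_cvg f : (fun N => \sum_(n < N) tcoef n f) @ \oo --> f.
Proof.
apply/nc_cvgP => w; apply: cvg_near_cst; near=> N.
have wN : (weight w < N)%N by near: N; exists (weight w).+1.
rewrite ncEsum (bigD1 (Ordinal wN)) //= {1}/tcoef eqxx big1 ?addr0// => k.
by rewrite -val_eqE /= /tcoef eq_sym => /negPf ->.
Unshelve. all: by end_near. Qed.

End Conj.

Section LieClosure.
Variable K : numFieldType.
Implicit Types (f g h : ncseries K) (w : word).
Hypothesis natr_inv : (fun n : nat => (n%:R : K)^-1 : K^o) @ \oo --> (0 : K^o).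
Variable M : set (ncseries K).
Hypothesis M1 : M 1.
Hypothesis MM : forall f g, M f -> M g -> M (f * g).

Lemma closure_map (phi : ncseries K -> ncseries K) : continuous phi ->
  (forall f, M f -> closure M (phi f)) -> forall f, closure M f -> closure M (phi f).
Proof.
move=> phic Mphi.
have cl : closed (phi @^-1` closure M).
  by apply: preimage_closed => [f _|]; [exact: phic|exact: closed_closure].
rewrite closure_id in cl.
by move=> f Mf; rewrite -[closure M _]/((phi @^-1` closure M) f) cl; apply: closureS Mf.
Qed.

(** The factors are moved to the closure one after the other, so that [closure_map] is applied in
    one variable at a time. *)
Lemma closureM f g : closure M f -> closure M g -> closure M (f * g).
Proof.
move=> Mf Mg; move: f Mf; apply: closure_map => [f|f Mf].
  by apply: (@nc_cvgM _ _ (nbhs f) _ id (fun=> g)) => //; exact: cvg_cst.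
move: g Mg; apply: closure_map => [g|g Mg].
  by apply: (@nc_cvgM _ _ (nbhs g) _ (fun=> f) id) => //; exact: cvg_cst.
exact/subset_closure/MM.
Qed.

Lemma closureX f n : closure M f -> closure M (f ^+ n).
Proof.
move=> Mf; elim: n => [|n IH]; first exact: subset_closure.
by rewrite exprS; apply: closureM.
Qed.

Lemma closure_lim (u : nat -> ncseries K) f : (forall n, closure M (u n)) ->
  u @ \oo --> f -> closure M f.
Proof.
by move=> Mu; apply: closed_cvg; [exact: closed_closure|exact: nearW].
Qed.

(** The Lie algebra of the closure of [M], described by one-parameter subgroups. [M] is only assumed
    to be a monoid, but as [c] takes all values the inverses [exp (- c f)] lie in the closure
    too. *)
Definition tangent : set (ncseries K) :=
  [set f | f [::] = 0 /\ forall c : K, closure M (pexp (c *: f))].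

Lemma tangent_lim (u : nat -> ncseries K) f : (forall n, tangent (u n)) ->
  u @ \oo --> f -> tangent f.
Proof.
move=> tu uf; split=> [|c].
  have /nc_cvgP/(_ [::]) := uf.
  under eq_fun do rewrite (tu _).1.
  by move/cvg_lim => <- //; rewrite lim_cst.
apply: (@closure_lim (fun n => pexp (c *: u n))) => [n|]; first exact: (tu n).2.
by apply: pser_cvg; apply: nc_cvgZ => //; exact: cvg_cst.
Qed.

Lemma tangent0 : tangent 0.
Proof. by split=> // c; rewrite scaler0 pexp0; exact: subset_closure. Qed.

Lemma tangent_lin c f g : tangent f -> tangent g -> tangent (c *: f + g).
Proof.
move=> [f0 tf] [g0 tg]; split=> [|a]; first by rewrite !ncE f0 g0 mulr0 addr0.
rewrite scalerDr; apply: (closure_lim _ (trotter natr_inv _ _)).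
- by move=> n; apply/closureX/closureM; rewrite !scalerA.
- by rewrite !ncE f0 !mulr0.
- by rewrite !ncE g0 !mulr0.
Qed.

Lemma tangent_lie f g : tangent f -> tangent g -> tangent (lie_bracket f g).
Proof.
move=> tf [g0 tg]; have f0 := tf.1.
(* The conjugate of [g] by [exp (f / n)]. Its exponentials are conjugates of those of [g], hence
   products of elements of the closure. *)
pose A (n : nat) : ncseries K := pexp (n%:R^-1 *: f) * g * pexp (- (n%:R^-1 *: f)).
have fn0 n : (n%:R^-1 *: f) [::] = 0 by rewrite ncE f0 mulr0.
have tA n : tangent (A n).
  split=> [|c]; first by rewrite /A !ncEMnil g0 mulr0 mul0r.
  set u := pexp (n%:R^-1 *: f); set v := pexp (- (n%:R^-1 *: f)).
  suff: closure M (pexp (u * (c *: g) * v)) by rewrite -scalerAr -scalerAl.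
  rewrite pexpJ; [|exact: pexpKV|exact: pexpVK|by rewrite ncE g0 mulr0].
  apply: closureM; first by apply: closureM => //; exact: tf.2.
  by rewrite /v -scaleNr; exact: tf.2.
suff H : (fun n => n%:R *: (A n - g)) @ \oo --> (lie_bracket f g : ncseries K).
  apply: (tangent_lim _ H) => n.
  have -> : n%:R *: (A n - g) = n%:R *: ((-1) *: g + A n) + 0.
    by rewrite scaleN1r addrC addr0.
  by apply: tangent_lin tangent0; apply: tangent_lin.
(* A discrete product rule: [u g v - g = (u - 1) (g v) + g (v - 1)]. *)
apply: (@cvg_trans _ ((fun n : nat =>
    n%:R *: (pexp (n%:R^-1 *: f) - 1) * (g * pexp (- (n%:R^-1 *: f)))
     + g * (n%:R *: (pexp (n%:R^-1 *: - f) - 1))) @ \oo)).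
  apply: near_eq_cvg; apply: nearW => n.
  rewrite -scalerAl -scalerAr -scalerDr scalerN; congr (_ *: _).
  by rewrite mulrBl mul1r mulrBr mulr1 addrA subrK mulrA.
rewrite /lie_bracket -mulrN; apply: nc_cvgD.
  apply: nc_cvgM; first exact: pexp_deriv0.
  apply: (cvg_to_eq (T := ncseries K) (mulr1 g)).
  apply: nc_cvgM; first exact: cvg_cst.
  have <- : pexp (- (0 *: f)) = 1 by rewrite scale0r oppr0 pexp0.
  by apply: pser_cvg; apply: nc_cvgN; apply: nc_cvgZ => //; exact: cvg_cst.
apply: nc_cvgM; first exact: cvg_cst.
by apply: pexp_deriv0 => //; rewrite ncE f0 oppr0.
Qed.

Hypothesis Mvar : forall c j, M (pexp (c *: ncvar K j)).

Lemma lie_generated_tangent n : lie_generated n `<=` tangent.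
Proof.
apply: smallest_sub.
  by split; [exact: tangent0|exact: tangent_lin|exact: tangent_lie].
by move=> _ [j _ <-]; split=> // c; exact: subset_closure.
Qed.

Lemma pexp_lie_closure f : lie_elements f -> closure M (pexp f).
Proof.
move=> [f0 lf]; rewrite -[f]scale1r; apply: (tangent_lim _ (@tcoef_cvg _ f)).2 => N.
elim/big_ind: _ => [|a b ta tb|[n nN] _] /=; first exact: tangent0.
  by rewrite -[a]scale1r; exact: tangent_lin.
(* [lie_elements] constrains only the parts of positive weight; the part of weight [0] vanishes with
   the constant term. *)
have [->|n0] := posnP n; first by rewrite tcoef0//; exact: tangent0.
exact: (@lie_generated_tangent n) (lf n n0).
Qed.

End LieClosure.

(** * Logarithmic derivatives and Lie polynomials *)

Section WeightDerivation.
Variable K : comNzRingType.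
Implicit Types (f g h : ncseries K) (w : word).

Definition wderiv f : ncseries K := fun w => (weight w)%:R * f w.

Lemma wderiv_nil f : wderiv f [::] = 0.
Proof. by rewrite /wderiv weight_nil mul0r. Qed.

Lemma wderivM f g : wderiv (f * g) = wderiv f * g + f * wderiv g.
Proof.
apply: ncext => w; rewrite ncED /wderiv !ncEM mulr_sumr -big_split /=.
apply: eq_bigr => k _; rewrite {1}(weight_take_drop k w) natrD mulrDl !mulrA.
by rewrite [_ * f _ in X in _ + X]mulrC.
Qed.

Lemma wderiv_agree n f g : agree n f g -> agree n (wderiv f) (wderiv g).
Proof. by move=> fg w wn; rewrite /wderiv fg. Qed.

(** Its fixed points are the solutions [p] of [wderiv g = p * g]. *)
Definition lderstep g p := wderiv g - p * (g - 1).

(** The logarithmic derivative [wderiv g * g^-1]. *)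
Definition logder g : ncseries K := ncfix (lderstep g).

Lemma lderstep_nil g p : p [::] = 0 -> lderstep g p [::] = 0.
Proof. by move=> p0; rewrite /lderstep !ncE ncEMnil p0 mul0r wderiv_nil subrr. Qed.

Lemma lderstep_contract g : g [::] = 1 -> forall n p p', p [::] = 0 ->
  p' [::] = 0 -> agree n p p' -> agree n.+1 (lderstep g p) (lderstep g p').
Proof.
move=> g1 n p p' p0 p0' pp; apply: agreeD => //; apply: agreeN.
by apply: agreeM0 => //; rewrite !ncE g1 subrr.
Qed.

Lemma logder_nil g : logder g [::] = 0.
Proof. by apply: ncfix_nil => p; exact: lderstep_nil. Qed.

Lemma logderE g : g [::] = 1 -> wderiv g = logder g * g.
Proof.
move=> g1; have /eqP : lderstep g (logder g) = logder g.
  by apply: ncfixE => [p|]; [exact: lderstep_nil|exact: lderstep_contract].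
by rewrite /lderstep mulrBr mulr1 opprB addrCA addrC -subr_eq0 addrK subr_eq0 => /eqP.
Qed.

Lemma logder_unique g p : g [::] = 1 -> wderiv g = p * g -> p = logder g.
Proof.
move=> g1 E; apply/eqP; rewrite -subr_eq0; apply/eqP; apply: (nc_rcancel g1).
by rewrite mulrBl -E -logderE// subrr.
Qed.

Lemma logder1 : logder 1 = 0.
Proof.
apply/esym/logder_unique => //; rewrite mul0r; apply: ncext => w.
rewrite /wderiv ncE1; case: w => [|j w]; last by rewrite mulr0.
by rewrite weight_nil mul0r.
Qed.

(** When [h] has constant term [1], [logder h - wderiv h = - (logder h * (h - 1))], a product of two
    series without constant term, whence the extra weight by [agreeM0]. *)
Lemma logder_agree n g g' : g [::] = 1 -> g' [::] = 1 -> agree n g g' ->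
  agree n.+1 (logder g - wderiv g) (logder g' - wderiv g').
Proof.
move=> g1 g1' gg.
have E h : h [::] = 1 -> logder h - wderiv h = - (logder h * (h - 1)).
  by move=> h1; rewrite mulrBr mulr1 -logderE// opprB.
(* [agreeM0] requires that the logarithmic derivatives themselves agree below weight [n]; this is
   proved one weight at a time by the same identity. *)
suff H m : (m <= n)%N -> agree m (logder g) (logder g').
  rewrite !E//; apply/agreeN/agreeM0; rewrite ?logder_nil ?ncE ?g1 ?g1' ?subrr//.
    exact: H.
  exact: agreeD.
elim: m => [_ w|m IH mn]; first by rewrite ltn0.
rewrite -[logder g](subrK (wderiv g)) -[logder g'](subrK (wderiv g')) !E//.
apply: agreeD; last exact/wderiv_agree/(agree_sub mn).
apply/agreeN/agreeM0; rewrite ?logder_nil ?ncE ?g1 ?g1' ?subrr//.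
  exact/IH/ltnW.
by apply: agreeD => //; apply: agree_sub gg; apply: ltnW.
Qed.

End WeightDerivation.

Section LieGenerated.
Variable K : comNzRingType.
Implicit Types (f g h : ncseries K) (w : word).

Lemma lie_generated_subalgebra n : lie_subalgebra (@lie_generated K n).
Proof.
split=> [S [[S0 _ _] _]|c f g Lf Lg S H|f g Lf Lg S H] //; have [[S0 Sl Sb] _] := H.
  by apply: Sl; [exact: Lf|exact: Lg].
by apply: Sb; [exact: Lf|exact: Lg].
Qed.

Lemma lie_generated0 n : @lie_generated K n 0.
Proof. by case: (lie_generated_subalgebra n). Qed.

Lemma lie_generated_lin n c f g :
  lie_generated n f -> lie_generated n g -> lie_generated n (c *: f + g).
Proof. by case: (lie_generated_subalgebra n) => _ + _; apply. Qed.

Lemma lie_generatedD n f g :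
  lie_generated n f -> lie_generated n g -> lie_generated n (f + g).
Proof. by move=> ? ?; rewrite -[f]scale1r; exact: lie_generated_lin. Qed.

Lemma lie_generatedZ n c f : lie_generated n f -> lie_generated n (c *: f).
Proof.
move=> ?; rewrite -[_ *: _]addr0; apply: lie_generated_lin => //.
exact: lie_generated0.
Qed.

Lemma lie_generated_bracket n f g :
  lie_generated n f -> lie_generated n g -> lie_generated n (lie_bracket f g).
Proof. by case: (lie_generated_subalgebra n) => _ _; apply. Qed.

Lemma lie_generated_var n j : (j < n)%N -> lie_generated n (ncvar K j).
Proof. by move=> jn S [_]; apply; exists j. Qed.

Lemma lie_generatedS m n : (m <= n)%N -> @lie_generated K m `<=` lie_generated n.
Proof.
move=> mn; apply: smallest_sub; first exact: lie_generated_subalgebra.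
by move=> _ [j jm <-]; apply: lie_generated_var; apply: leq_trans mn.
Qed.

Lemma lie_generated_sum n I (r : seq I) (P : pred I) (F : I -> ncseries K) :
  (forall i, P i -> lie_generated n (F i)) ->
  lie_generated n (\sum_(i <- r | P i) F i).
Proof.
move=> H; elim/big_ind: _ => //; [exact: lie_generated0|exact: lie_generatedD].
Qed.

Lemma tcoefD n f g : tcoef n (f + g) = tcoef n f + tcoef n g.
Proof.
apply: ncext => w; rewrite ncED /tcoef; case: eqP => //; by rewrite addr0.
Qed.

Lemma tcoefN n f : tcoef n (- f) = - tcoef n f.
Proof.
apply: ncext => w; rewrite ncEN /tcoef; case: eqP => //; by rewrite oppr0.
Qed.

Lemma tcoefM n f g : tcoef n (f * g) = \sum_(i < n.+1) tcoef i f * tcoef (n - i) g.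
Proof.
apply: ncext => w; rewrite ncEsum; under eq_bigr do rewrite ncEM.
rewrite exchange_big /= /tcoef.
have [wn|wn] := eqVneq; last first.
  rewrite big1 // => k _; rewrite big1 // => -[i /= iN] _; rewrite ltnS in iN.
  have [E1|] := eqVneq; last by rewrite mul0r.
  have [E2|] := eqVneq; last by rewrite mulr0.
  by case/eqP: wn; rewrite (weight_take_drop k w) E1 E2 subnKC.
apply: eq_bigr => k _.
have kn : (weight (take k w) < n.+1)%N.
  by rewrite ltnS -wn (weight_take_drop k w) leq_addr.
have dn : weight (drop k w) = (n - weight (take k w))%N.
  by rewrite -wn (weight_take_drop k w) addKn.
rewrite (bigD1 (Ordinal kn)) //= eqxx dn eqxx big1 ?addr0// => i.
by rewrite -val_eqE /= eq_sym => /negPf ->; rewrite mul0r.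
Qed.

Lemma tcoef_bracket n f g : tcoef n (lie_bracket f g) =
  \sum_(i < n.+1) lie_bracket (tcoef i f) (tcoef (n - i) g).
Proof.
rewrite /lie_bracket tcoefD tcoefN !tcoefM sumrB; congr (_ - _).
rewrite (reindex_inj rev_ord_inj) /=; apply: eq_bigr => i _.
by rewrite !subSS subKn// -ltnS.
Qed.

(** Stated as a vanishing condition, which passes at once from [f] to [wderiv f]. *)
Definition linear_letters f := forall w, size w != 1%N -> f w = 0.

Lemma tcoef_letters n f : linear_letters f -> tcoef n.+1 f = f [:: n] *: ncvar K n.
Proof.
move=> fl; apply: ncext => w; rewrite ncEZ /tcoef /ncvar.
case: (eqVneq (size w) 1%N) => [|w1]; last first.
  by rewrite fl// if_same; have [E|_] := eqVneq w [:: n]; [rewrite E in w1|rewrite mulr0].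
case: w => [|j [|]] //= _; rewrite weight_cons weight_nil addn0 eqSS.
rewrite -[[:: j] == _]/((j == n) && true) andbT.
by case: eqP => [->|]; rewrite ?mulr1 ?mulr0.
Qed.

Lemma tcoef_letters0 f : linear_letters f -> tcoef 0 f = 0.
Proof.
move=> fl; apply: ncext => w; rewrite /tcoef; case: eqP => //.
by case: w => [|j w]; rewrite ?weight_cons// fl.
Qed.

Lemma lie_tcoef_letters n f : linear_letters f -> lie_generated n (tcoef n f).
Proof.
case: n => [|n] fl; first by rewrite tcoef_letters0//; exact: lie_generated0.
by rewrite tcoef_letters//; apply: lie_generatedZ; exact: lie_generated_var.
Qed.

Lemma wderiv_letters f : linear_letters f -> linear_letters (wderiv f).
Proof. by move=> fl w w1; rewrite /wderiv fl// mulr0. Qed.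

(** The weight [n] part of [[a, p]] pairs the part [i] of [a] with the part [n - i] of [p]. As [a]
    has no part of weight [0], only parts of [p] of weight below [n] occur: this drives the
    induction on the weight along a path. *)
Lemma lie_tcoef_bracket_letters n a p : linear_letters a ->
  (forall m, (m < n)%N -> lie_generated m (tcoef m p)) ->
  lie_generated n (tcoef n (lie_bracket a p)).
Proof.
move=> al pl; rewrite tcoef_bracket; apply: lie_generated_sum => -[[|i] iN] _ /=.
  rewrite tcoef_letters0// /lie_bracket mul0r mulr0 subrr.
  exact: lie_generated0.
apply: lie_generated_bracket.
  exact: (@lie_generatedS i.+1 n iN) (@lie_tcoef_letters i.+1 _ al).
have ni : (n - i.+1 < n)%N by rewrite ltn_subrL; case: (n) iN.
exact: (lie_generatedS (ltnW ni)) (pl _ ni).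
Qed.

End LieGenerated.

(** * Lie polynomials of a given weight as zeros of linear functionals *)

Section Functionals.
Variable K : fieldType.

(** Take for [A] the cokernel of a matrix of maximal rank with rows in [U]. *)
Lemma rV_subspace_kernel N (U : set 'rV[K]_N) : U 0 ->
  (forall c u v, U u -> U v -> U (c *: u + v)) ->
  exists A : 'M[K]_N, forall v, U v <-> v *m A = 0.
Proof.
move=> U0 Ul.
pose P r := `[< exists A : 'M[K]_N, (forall i, U (row i A)) /\ \rank A = r >].
have Pex : exists r, P r.
  exists 0%N; apply/asboolP; exists 0; rewrite mxrank0; split=> // i.
  by rewrite row0.
have Pub r : P r -> (r <= N)%N by move=> /asboolP[A [_ <-]]; exact: rank_leq_row.
case: (ex_maxnP Pex Pub) => r /asboolP[A [UA Ar]] maxr; exists (cokermx A).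
have Usum I (s : seq I) (F : I -> 'rV[K]_N) : (forall i, U (F i)) -> U (\sum_(i <- s) F i).
  by move=> H; elim/big_ind: _ => // a b ? ?; rewrite -[a]scale1r; exact: Ul.
have UZ c u : U u -> U (c *: u) by move=> ?; rewrite -[_ *: _]addr0; exact: Ul.
have Umul m (B : 'M[K]_(m, N)) u : (forall i, U (row i B)) -> U (u *m B).
  by move=> UB; rewrite mulmx_sum_row; apply: Usum => i; exact: UZ.
move=> v; split=> [Uv|/eqP]; last first.
  by rewrite -submxE => /submxP[u ->]; exact: Umul.
apply/eqP; rewrite -submxE; apply: contraT => vA.
(* A vector of [U] outside the row space of [A] could be joined to it, giving rows in [U] of larger
   rank, against maximality. *)
suff : P (\rank (A + v)%MS) /\ (r < \rank (A + v)%MS)%N.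
  by move=> [/maxr H1 H2]; move: (leq_ltn_trans H1 H2); rewrite ltnn.
split.
  apply/asboolP; exists (A + v)%MS; split=> // i.
  have /sub_addsmxP[[u c] ->] : (row i (A + v)%MS <= A + v)%MS by exact: row_sub.
  rewrite -[u *m A]scale1r; apply: Ul; apply: Umul => // j.
  by rewrite (_ : row j v = v)//; apply/rowP => k; rewrite !mxE !ord1.
rewrite -Ar ltn_neqAle mxrankS ?addsmxSl// andbT.
apply: contra vA => /eqP E; apply: submx_trans (addsmxSr A v) _.
by rewrite -(geq_leqif (mxrank_leqif_sup (addsmxSl A v))) E.
Qed.

(** A word of weight [n + 1] is a letter [j] followed by a word of weight [n - j], so a finite list
    is built by strong induction. *)
Lemma words_of_weight n : exists2 s : seq word, uniq s &
  forall w, (w \in s) = (weight w == n).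
Proof.
suff [s sP] : exists s : seq word, forall w, weight w = n -> w \in s.
  exists (undup [seq w <- s | weight w == n]) => [|w]; first exact: undup_uniq.
  by rewrite mem_undup mem_filter; case: eqP => //= /sP.
elim/ltn_ind: n => -[|n] IH.
  by exists [:: [::]] => -[|j w]; rewrite ?weight_cons// inE.
have [L LP] : exists L : nat -> seq word, forall m, (m < n.+1)%N -> forall w,
    weight w = m -> w \in L m.
  have /choice[L LP] : forall m, exists s : seq word, (m < n.+1)%N -> forall w,
      weight w = m -> w \in s.
    move=> m; case: (ltnP m n.+1) => mn; last by exists [::].
    by have [s sP] := IH _ mn; exists s.
  by exists L.
exists [seq j :: w | j <- iota 0 n.+1, w <- L (n - j)%N] => -[|j w].
  by rewrite weight_nil.
rewrite weight_cons addSn => -[E]; apply/allpairsPdep; exists j, w; split => //.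
  by rewrite mem_iota ltnS -E leq_addr.
by apply: LP; rewrite ?ltnS ?leq_subr// -E addKn.
Qed.

(** Words of weight [n] being finite in number, the Lie condition at weight [n] defines a subspace
    of a finite-dimensional space, hence finitely many linear equations. In this form it can be
    differentiated along a path and passes to limits. *)
Lemma lie_functionals n : exists N (s : 'I_N -> word) (A : 'M[K]_N),
  forall f : ncseries K, lie_generated n (tcoef n f) <->
    forall j, \sum_i f (s i) * A i j = 0.
Proof.
have [s su sP] := words_of_weight n.
exists (size s), (fun i => nth [::] s i).
pose G (v : 'rV[K]_(size s)) : ncseries K :=
  fun w => \sum_(i < size s) (if w == nth [::] s i then v 0 i else 0).
have GE (f : ncseries K) : tcoef n f = G (\row_(i < size s) f (nth [::] s i)).
  apply: ncext => w; rewrite /tcoef /G -sP.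
  case: (boolP (w \in s)) => ws; last first.
    rewrite big1 // => i _; case: eqP => // E.
    by move: ws; rewrite E mem_nth.
  rewrite -index_mem in ws; rewrite (bigD1 (Ordinal ws)) //= mxE /=.
  rewrite nth_index -?index_mem// eqxx big1 ?addr0// => i /eqP iN.
  case: eqP => // wE; case: iN; apply: val_inj.
  by rewrite /= wE index_uniq.
have [||A AP] := @rV_subspace_kernel _ [set v | lie_generated n (G v)].
- rewrite /= (_ : G 0 = 0); first exact: lie_generated0.
  by apply: ncext => w; rewrite /G big1// => i _; rewrite mxE if_same.
- move=> c u v /= Gu Gv.
  rewrite (_ : G _ = c *: G u + G v); first exact: lie_generated_lin.
  apply: ncext => w; rewrite ncED ncEZ /G mulr_sumr -big_split /=.
  by apply: eq_bigr => i _; rewrite !mxE; case: eqP; rewrite ?mulr0 ?addr0.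
exists A => f; rewrite GE; apply: (iff_trans (AP _)); split=> [/rowP H j|H].
  by have := H j; rewrite !mxE => {2}<-; apply: eq_bigr => i _; rewrite mxE.
by apply/rowP => j; rewrite !mxE -[RHS](H j); apply: eq_bigr => i _; rewrite mxE.
Qed.

End Functionals.

(** * Lipschitz functions and solutions *)

Section RealFunctions.
Variable R : realType.
Implicit Types (f g : R -> R) (x : R).
Local Notation mu := (@lebesgue_measure R).

Lemma is_derive0_small f x : is_derive x (1 : R) f 0 ->
  forall e, 0 < e -> exists2 d, 0 < d &
    forall y, `|y - x| < d -> `|f y - f x| <= e * `|y - x|.
Proof.
move=> [df dE] e e0.
have : h^-1 *: (f (h *: (1 : R) + x) - f x) @[h --> 0^'] --> 'D_1 f x.
  exact: df.
rewrite dE => /cvgrPdist_le /(_ e e0) [d /= d0 H]; exists d => // y yd.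
have [->|yx] := eqVneq y x; first by rewrite !subrr !normr0 mulr0.
have := H (y - x); rewrite /= sub0r normrN => /(_ yd).
rewrite subr_eq0 => /(_ yx).
rewrite /GRing.scale /= mulr1 subrK sub0r normrN normrM normfV ler_pdivrMl.
  by rewrite mulrC.
by rewrite normr_gt0 subr_eq0.
Qed.

Definition rlip (T : R) f := exists2 C, 0 <= C & forall x y,
  x \in `[0, T] -> y \in `[0, T] -> `|f x - f y| <= C * `|x - y|.

Lemma rlipP T f : [lipschitz f x | x in `[0, T]%classic] <-> rlip T f.
Proof.
split=> [[M [Mr H]]|[C C0 H]].
  have M1 : M < `|M| + 1 by rewrite ltr_pwDr// ler_norm.
  exists (`|M| + 1); first by rewrite addr_ge0.
  by move=> x y xT yT; apply: (H _ M1 (x, y)).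
exists C; split=> [|c Cc [x y] [/= xT yT]]; first exact: num_real.
by apply: le_trans (H x y xT yT) _; rewrite ler_wpM2r// ltW.
Qed.

(** Cover the exceptional null set by an open set [U] of small measure; then
    [`|f y - f 0| <= C * mu (U `&` `[0, y]) + r * y] propagates from [0] to [T]. *)
Lemma rlip_ae_const T f : rlip T f ->
  {ae mu, forall x, x \in `]0, T[ -> is_derive x (1 : R) f 0} ->
  forall x, x \in `[0, T] -> f x = f 0.
Proof.
move=> [C C0 fC] [A [mA A0 AP]] x xT.
have T0 : 0 <= T by move: xT; rewrite in_itv /= => /andP[]; exact: le_trans.
suff H e : 0 < e -> `|f x - f 0| <= e.
  apply/eqP; rewrite -subr_eq0 -normr_le0; apply/ler_addgt0Pl => e e0.
  by rewrite addr0 H.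
(* Chosen so that the final bound [C * r + r * T] is at most [e]. *)
move=> e0; pose r := e / (C + T + 1).
have D0 : 0 < C + T + 1 by rewrite ltr_wpDl// addr_ge0.
have r0 : 0 < r by rewrite divr_gt0.
(* The derivative is known on the open interval only, so [0] joins the exceptional set. *)
pose N := A `|` [set 0].
have mN : measurable N by apply: measurableU.
have N0 : mu N = 0%E.
  by rewrite measureU0//; exact: lebesgue_measure_set1.
have Noo : (mu N < +oo)%E by rewrite N0.
have [U [oU NU mUN]] := lebesgue_regularity_outer mN Noo r0.
have mU : measurable U by exact: measurable_realfun.open_measurable.
have mUr : (mu U < r%:E)%E.
  have -> : U = (U `\` N) `|` N by rewrite setUC setDUK.
  by rewrite measureU0//; exact: measurableD.
pose m y := fine (mu (U `&` `[0, y])).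
have mfin B : measurable B -> mu (U `&` B) \is a fin_num.
  move=> mB; rewrite ge0_fin_numE//; apply: le_lt_trans (ltry r).
  apply: le_trans (ltW mUr); apply: le_measure; rewrite ?inE//.
  exact: measurableI.
have mS y z : 0 <= y -> y <= z -> m z = m y + fine (mu (U `&` `]y, z])).
  move=> y0 yz; rewrite /m -fineD; try exact: mfin.
  rewrite -measureU; [|exact: measurableI|exact: measurableI|]; last first.
    apply/seteqP; split=> // t [[_ /=]]; rewrite !in_itv /= => /andP[_ ty].
    by move=> [_ /andP[yt _]]; move: (lt_le_trans yt ty); rewrite ltxx.
  rewrite -setIUr; congr (fine (mu (_ `&` _))).
  by rewrite -itv_bndbnd_setU// bnd_simp.
have m_ge0 y : 0 <= m y by rewrite fine_ge0.
have m_le y : m y <= r.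
  rewrite -lee_fin fineK; last exact: mfin.
  apply: le_trans (ltW mUr); apply: le_measure; rewrite ?inE//.
  exact: measurableI.
have m_mono y z : 0 <= y -> y <= z -> m y <= m z.
  by move=> y0 yz; rewrite (mS y z)// lerDl fine_ge0.
have m_in y z : 0 <= y -> y <= z -> `]y, z] `<=` U -> m z = m y + (z - y).
  move=> y0 yz sU; rewrite (mS y z)//; congr (_ + _).
  rewrite (setIidr sU) lebesgue_measure_itv /= lte_fin.
  by case: ltP => // zy; apply/esym/eqP; rewrite subr_eq0 eq_le zy yz.
pose good y := `|f y - f 0| <= C * m y + r * y.
suff gx : forall y, y \in `[0, T] -> good y.
  apply: le_trans (gx _ xT) _.
  rewrite (@le_trans _ _ (C * r + r * T))//.
    apply: lerD; first exact: ler_wpM2l.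
    apply: ler_wpM2l; first exact: ltW.
    by move: xT; rewrite in_itv /= => /andP[].
  rewrite mulrC -mulrDr /r mulrAC -mulrA.
  by apply: ler_piMr; [exact: ltW|rewrite ler_pdivrMr// mul1r lerDl].
(* Continuous induction: the supremum of [S] is shown to belong to [S], then to equal [T]. *)
pose S := [set s | s \in `[0, T] /\ forall y, y \in `[0, s] -> good y].
have S0 : S 0.
  split=> [|y]; first by rewrite in_itv /= lexx.
  rewrite in_itv /= => /andP[y0 y1]; have -> : y = 0 by apply/eqP; rewrite eq_le y0 y1.
  by rewrite /good subrr normr0 mulr0 addr0 mulr_ge0.
have supS : has_sup S.
  by split; [exists 0|exists T => s [+ _]; rewrite in_itv => /andP[]].
pose s := sup S.
have sT : s \in `[0, T].
  rewrite in_itv /=; apply/andP; split; first by apply: ub_le_sup => //; exact: supS.2.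
  by apply: ge_sup; [exists 0|move=> t [+ _]; rewrite in_itv => /andP[]].
have [s0 sT'] : 0 <= s /\ s <= T by move: sT; rewrite in_itv => /andP.
have goodlt y : y \in `[0, T] -> y < s -> good y.
  move=> yT ys; have [t [tT tS] yt] := @sup_gt _ S y supS.1 ys.
  by apply: tS; rewrite in_itv /= (ltW yt) andbT; move: yT; rewrite in_itv => /andP[].
have goods : good s.
  have [->|sN0] := eqVneq s 0; first by apply: S0.2; rewrite in_itv /= lexx.
  have s_gt0 : 0 < s by rewrite lt_neqAle eq_sym sN0.
  apply/ler_addgt0Pl => d d0.
  (* Close enough to [s] for the Lipschitz bound on [f s - f y] to be at most [d]. *)
  pose y := Num.max 0 (s - d / (C + 1)).
  have C1 : 0 < C + 1 by rewrite ltr_wpDl.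
  have y0 : 0 <= y by rewrite le_max lexx.
  have ys : y < s by rewrite gt_max s_gt0 ltrBlDr ltrDl divr_gt0.
  have yT : y \in `[0, T] by rewrite in_itv /= y0 (le_trans (ltW ys)).
  have := goodlt y yT ys; rewrite /good => gy.
  have -> : f s - f 0 = (f s - f y) + (f y - f 0) by rewrite addrA subrK.
  apply: le_trans (ler_normD _ _) _; apply: lerD; last first.
    apply: le_trans gy _; apply: lerD; first by rewrite ler_wpM2l// m_mono// ltW.
    by rewrite ler_wpM2l// ltW.
  apply: le_trans (fC s y sT yT) _; rewrite ger0_norm ?subr_ge0 ?(ltW ys)//.
  apply: (@le_trans _ _ (C * (d / (C + 1)))).
    rewrite ler_wpM2l// lerBlDr -lerBlDl le_max lexx; exact: orbT.
  rewrite mulrCA; apply: ler_piMr; first exact: ltW.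
  by rewrite ler_pdivrMr// mul1r lerDl.
have Ss : S s.
  split=> // y; rewrite in_itv /= => /andP[y0]; rewrite le_eqVlt => /orP[/eqP->//|ys].
  by apply: goodlt => //; rewrite in_itv /= y0 (le_trans (ltW ys)).
suff sE : s = T by rewrite -sE; exact: Ss.2.
apply/eqP; rewrite eq_le sT' leNgt; apply/negP => sltT.
have [d d0 dP] : exists2 d, 0 < d & forall y, s <= y -> y < s + d -> y <= T -> good y.
  have step y : s <= y -> y <= T ->
      (`|f y - f s| <= C * (m y - m s) + r * (y - s)) -> good y.
    move=> sy yT H.
    rewrite /good (_ : f y - f 0 = (f y - f s) + (f s - f 0)); last by rewrite addrA subrK.
    apply: le_trans (ler_normD _ _) _; apply: le_trans (lerD H goods) _.
    by rewrite addrACA -mulrDr -mulrDr !subrK.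
  (* If [s] is exceptional, [U] contains a neighbourhood of [s], so [m] grows there with slope one
     and pays for the Lipschitz bound. Otherwise the derivative at [s] is [0] and the slope [r]
     suffices. *)
  have [sN|sN] := pselect (N s).
    have /nbhs_ballP[d /= d0 dU] : nbhs s U by apply: open_nbhs_nbhs; split=> //; exact: NU.
    exists d => // y sy yd yT; apply: step => //.
    have yT' : y \in `[0, T] by rewrite in_itv /= (le_trans s0 sy).
    rewrite (m_in s y)// => [|t /=].
      rewrite [m s + _]addrC addrK; apply: le_trans (fC y s yT' sT) _.
      by rewrite ger0_norm ?subr_ge0// lerDl; apply: mulr_ge0; [exact: ltW|rewrite subr_ge0].
    rewrite in_itv /= => /andP[st ty]; apply: dU; rewrite /ball /= ltr_norml.
    by apply/andP; split; lra.
  have s_gt0 : 0 < s.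
    rewrite lt_neqAle s0 andbT; apply/eqP => s0'; apply: sN; right.
    by rewrite /= -s0'.
  have ds : is_derive s (1 : R) f 0.
    apply: contrapT => nds; apply: sN; left; apply: AP => /= /(_ _)/nds; apply.
    by rewrite in_itv /= s_gt0.
  have [d d0 dP] := is_derive0_small ds r0.
  exists d => // y sy yd yT; apply: step => //.
  apply: le_trans (dP y _) _; first by rewrite ger0_norm ?subr_ge0//; lra.
  rewrite ger0_norm ?subr_ge0// lerDr; apply: mulr_ge0 => //.
  by rewrite subr_ge0 m_mono.
pose t := Num.min T (s + d / 2).
have st : s < t by rewrite lt_min sltT ltrDl divr_gt0.
have tS : S t.
  split=> [|y].
    by rewrite in_itv /= (le_trans s0 (ltW st)) ge_min lexx.
  rewrite in_itv /= => /andP[y0 yt]; have [ys|sy] := leP y s.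
    by apply: Ss.2; rewrite in_itv /= y0.
  move: yt; rewrite le_min => /andP[yT yd]; apply: dP => //; first exact: ltW.
  by apply: le_lt_trans yd _; rewrite ltrD2l; lra.
have : t <= s by apply: ub_le_sup => //; exact: supS.2.
by rewrite leNgt st.
Qed.

End RealFunctions.

(** * Calculus of complex and series valued functions of a real variable *)

Section ComplexDerivative.
Variable R : realType.
Implicit Types (f g : R -> R[i]) (F G : R -> ncseries R[i]) (x T : R).

Definition cderiv f x (df : R[i]) :=
  is_derive x (1 : R) (fun y => complex.Re (f y)) (complex.Re df) /\
  is_derive x (1 : R) (fun y => complex.Im (f y)) (complex.Im df).

Lemma ReD (a b : R[i]) : complex.Re (a + b) = complex.Re a + complex.Re b.
Proof. by case: a; case: b. Qed.

Lemma ImD (a b : R[i]) : complex.Im (a + b) = complex.Im a + complex.Im b.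
Proof. by case: a; case: b. Qed.

Lemma ReM (a b : R[i]) : complex.Re (a * b) =
  complex.Re a * complex.Re b - complex.Im a * complex.Im b.
Proof. by case: a; case: b. Qed.

Lemma ImM (a b : R[i]) : complex.Im (a * b) =
  complex.Re a * complex.Im b + complex.Im a * complex.Re b.
Proof. by case: a; case: b. Qed.

Lemma complex_ext (a b : R[i]) : complex.Re a = complex.Re b ->
  complex.Im a = complex.Im b -> a = b.
Proof. by case: a; case: b => ? ? ? ? /= -> ->. Qed.

Lemma cderiv_cst (c : R[i]) x : cderiv (fun=> c) x 0.
Proof. by split; apply: is_derive_cst. Qed.

Lemma cderivD f g x df dg : cderiv f x df -> cderiv g x dg ->
  cderiv (fun y => f y + g y) x (df + dg).
Proof.
move=> [fr fi] [gr gi]; split; rewrite ?ReD ?ImD.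
  under eq_fun do rewrite ReD; exact: is_deriveD.
under eq_fun do rewrite ImD; exact: is_deriveD.
Qed.

Lemma cderivN f x df : cderiv f x df -> cderiv (fun y => - f y) x (- df).
Proof.
move=> [fr fi]; split; rewrite raddfN /=.
  under eq_fun do rewrite raddfN; exact: is_deriveN.
under eq_fun do rewrite raddfN; exact: is_deriveN.
Qed.

Lemma is_derive_mul (f g : R -> R) x df dg : is_derive x (1 : R) f df ->
  is_derive x (1 : R) g dg ->
  is_derive x (1 : R) (fun y => f y * g y) (df * g x + f x * dg).
Proof.
move=> fd gd; have H := is_deriveM fd gd; apply: (is_derive_eq H).
by rewrite /GRing.scale /= addrC [g x * _]mulrC.
Qed.

Lemma cderivM f g x df dg : cderiv f x df -> cderiv g x dg ->
  cderiv (fun y => f y * g y) x (df * g x + f x * dg).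
Proof.
move=> [fr fi] [gr gi]; split.
  under eq_fun do rewrite ReM.
  have H := is_deriveB (is_derive_mul fr gr) (is_derive_mul fi gi).
  by apply: (is_derive_eq H); rewrite ReD !ReM; ring.
under eq_fun do rewrite ImM.
have H := is_deriveD (is_derive_mul fr gi) (is_derive_mul fi gr).
by apply: (is_derive_eq H); rewrite ImD !ImM; ring.
Qed.

Lemma cderiv_sum (I : Type) (r : seq I) (P : pred I) (f : I -> R -> R[i]) x
    (df : I -> R[i]) : (forall i, cderiv (f i) x (df i)) ->
  cderiv (fun y => \sum_(i <- r | P i) f i y) x (\sum_(i <- r | P i) df i).
Proof.
move=> H; elim: r => [|i r IH].
  by rewrite big_nil; under eq_fun do rewrite big_nil; exact: cderiv_cst.
rewrite big_cons; under eq_fun do rewrite big_cons.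
by case: (P i) => //; apply: cderivD.
Qed.

Lemma cderiv_unique f x a b : cderiv f x a -> cderiv f x b -> a = b.
Proof.
move=> [[_ ar] [_ ai]] [[_ br] [_ bi]].
by apply: complex_ext; rewrite -?ar -?ai.
Qed.

Lemma is_derive_near (f g : R -> R) x d : (\near x, f x = g x) ->
  is_derive x (1 : R) f d -> is_derive x (1 : R) g d.
Proof.
move=> fg [df dE]; split; first exact: near_eq_derivable df.
by rewrite -dE; apply/esym/near_eq_derive.
Qed.

Lemma cderiv_near f g x d : (\near x, f x = g x) -> cderiv f x d -> cderiv g x d.
Proof.
by move=> fg [fr fi]; split; [apply: is_derive_near fr|apply: is_derive_near fi];
  apply: filterS fg => y ->.
Qed.

Definition clip T f := rlip T (fun y => complex.Re (f y)) /\
  rlip T (fun y => complex.Im (f y)).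

Lemma rlip_cst T (c : R) : rlip T (fun=> c).
Proof. by exists 0 => // x y _ _; rewrite subrr normr0 mul0r. Qed.

Lemma rlipD T (f g : R -> R) : rlip T f -> rlip T g -> rlip T (fun y => f y + g y).
Proof.
move=> [C C0 fC] [D D0 gD]; exists (C + D); first exact: addr_ge0.
move=> x y xT yT; rewrite opprD addrACA mulrDl.
by apply: le_trans (ler_normD _ _) _; apply: lerD; [exact: fC|exact: gD].
Qed.

Lemma rlipN T (f : R -> R) : rlip T f -> rlip T (fun y => - f y).
Proof.
move=> [C C0 fC]; exists C => // x y xT yT.
by rewrite -opprD normrN; exact: fC.
Qed.

Lemma rlip_bounded T (f : R -> R) : rlip T f ->
  exists2 B, 0 <= B & forall x, x \in `[0, T] -> `|f x| <= B.
Proof.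
move=> [C C0 fC]; exists (`|f 0| + C * `|T|) => [|x xT].
  by rewrite addr_ge0// mulr_ge0.
have /andP[x0 xT'] : (0 <= x) && (x <= T) by rewrite in_itv in xT.
have T0 : 0 \in `[0, T] by rewrite in_itv /= lexx (le_trans x0).
rewrite -[f x](subrK (f 0)) addrC; apply: le_trans (ler_normD _ _) _.
rewrite lerD2l; apply: le_trans (fC _ _ xT T0) _; rewrite ler_wpM2l// subr0.
by rewrite !ger0_norm// (le_trans x0).
Qed.

Lemma rlipM T (f g : R -> R) : rlip T f -> rlip T g -> rlip T (fun y => f y * g y).
Proof.
move=> fL gL; have [A A0 fA] := rlip_bounded fL; have [B B0 gB] := rlip_bounded gL.
have [[C C0 fC] [D D0 gD]] := (fL, gL).
exists (C * B + A * D) => [|x y xT yT]; first by rewrite addr_ge0// mulr_ge0.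
have -> : f x * g x - f y * g y = (f x - f y) * g x + f y * (g x - g y) by ring.
apply: le_trans (ler_normD _ _) _; rewrite [leRHS]mulrDl !normrM; apply: lerD.
  by rewrite mulrAC ler_pM// ?fC// ?gB.
by rewrite -mulrA ler_pM// ?fA// gD.
Qed.

Lemma clip_cst T (c : R[i]) : clip T (fun=> c).
Proof. by split; exact: rlip_cst. Qed.

Lemma clipD T f g : clip T f -> clip T g -> clip T (fun y => f y + g y).
Proof.
move=> [fr fi] [gr gi]; split.
  by under eq_fun do rewrite raddfD; exact: rlipD.
by under eq_fun do rewrite raddfD; exact: rlipD.
Qed.

Lemma clipN T f : clip T f -> clip T (fun y => - f y).
Proof.
move=> [fr fi]; split.
  by under eq_fun do rewrite raddfN; exact: rlipN.
by under eq_fun do rewrite raddfN; exact: rlipN.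
Qed.

Lemma clipM T f g : clip T f -> clip T g -> clip T (fun y => f y * g y).
Proof.
move=> [fr fi] [gr gi]; split.
  under eq_fun do rewrite ReM; apply: rlipD; first exact: rlipM.
  by apply: rlipN; exact: rlipM.
by under eq_fun do rewrite ImM; apply: rlipD; exact: rlipM.
Qed.

Lemma clip_sum T (I : Type) (r : seq I) (P : pred I) (f : I -> R -> R[i]) :
  (forall i, clip T (f i)) -> clip T (fun y => \sum_(i <- r | P i) f i y).
Proof.
move=> H; elim: r => [|i r IH].
  by under eq_fun do rewrite big_nil; exact: clip_cst.
under eq_fun do rewrite big_cons.
by case: (P i) => //; apply: clipD.
Qed.

Lemma lebesgue_ae_imply (P Q : R -> Prop) : (forall x, P x -> Q x) ->
  {ae (@lebesgue_measure R), forall x, P x} ->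
  {ae (@lebesgue_measure R), forall x, Q x}.
Proof.
move=> PQ [A [mA A0 PA]]; exists A; split=> // x nQ.
by apply: PA => Px; apply: nQ; apply: PQ.
Qed.

Lemma clip_ae_const T f : clip T f ->
  {ae (@lebesgue_measure R), forall x, x \in `]0, T[ -> cderiv f x 0} ->
  forall x, x \in `[0, T] -> f x = f 0.
Proof.
move=> [fr fi] ae x xT; apply: complex_ext.
  apply: (rlip_ae_const fr) xT; apply: lebesgue_ae_imply ae => y H yT.
  by have [] := H yT.
apply: (rlip_ae_const fi) xT; apply: lebesgue_ae_imply ae => y H yT.
by have [] := H yT.
Qed.

Definition ncderiv F x (dF : ncseries R[i]) := forall w, cderiv (fun y => F y w) x (dF w).

Definition nclip T F := forall w, clip T (fun y => F y w).

Lemma ncderiv_cst c x : ncderiv (fun=> c) x 0.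
Proof. by move=> w; exact: cderiv_cst. Qed.

Lemma ncderivB F G x dF dG : ncderiv F x dF -> ncderiv G x dG ->
  ncderiv (fun y => F y - G y) x (dF - dG).
Proof. by move=> Fx Gx w; apply: cderivD => //; exact: cderivN. Qed.

Lemma ncderivM F G x dF dG : ncderiv F x dF -> ncderiv G x dG ->
  ncderiv (fun y => F y * G y) x (dF * G x + F x * dG).
Proof.
move=> Fx Gx w; rewrite ncED !ncEM -big_split /=.
by apply: cderiv_sum => k; exact: cderivM.
Qed.

Lemma ncderiv_wderiv F x dF : ncderiv F x dF ->
  ncderiv (fun y => wderiv (F y)) x (wderiv dF).
Proof.
move=> Fx w; rewrite /wderiv -[X in cderiv _ _ X]add0r.
rewrite -[X in cderiv _ _ (X + _)](mul0r (F x w)).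
by apply: cderivM => //; exact: cderiv_cst.
Qed.

Lemma ncderiv_unique F x a b : ncderiv F x a -> ncderiv F x b -> a = b.
Proof. by move=> Fa Fb; apply: ncext => w; apply: cderiv_unique (Fa w) (Fb w). Qed.

Lemma ncderiv_near F G x d : (\near x, F x = G x) -> ncderiv F x d -> ncderiv G x d.
Proof.
by move=> FG Fd w; apply: cderiv_near (Fd w); apply: filterS FG => y ->.
Qed.

Lemma nclip_cst T c : nclip T (fun=> c).
Proof. by move=> w; exact: clip_cst. Qed.

Lemma nclipB T F G : nclip T F -> nclip T G -> nclip T (fun y => F y - G y).
Proof. by move=> FL GL w; apply: clipD => //; exact: clipN. Qed.

Lemma nclipM T F G : nclip T F -> nclip T G -> nclip T (fun y => F y * G y).
Proof. by move=> FL GL w; apply: clip_sum => k; apply: clipM. Qed.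

Lemma nclip_wderiv T F : nclip T F -> nclip T (fun y => wderiv (F y)).
Proof. by move=> FL w; apply: clipM => //; exact: clip_cst. Qed.

Lemma nclip_logder T F : nclip T F -> nclip T (fun y => logder (F y)).
Proof.
move=> FL w; rewrite /logder /ncfix; move: (weight w).+1 => n.
suff : nclip T (fun y => iter n (lderstep (F y)) 0) by apply.
elim: n => [|n IH]; first exact: nclip_cst.
apply: nclipB; first exact: nclip_wderiv.
by apply: nclipM => //; apply: nclipB => //; exact: nclip_cst.
Qed.

(** Each coefficient of [logder (F y)] is that of a finite iterate, a polynomial in the coefficients
    of [F y]. Only existence is needed: [ncderiv_logder] identifies the value. *)
Lemma ncderiv_logder_ex F x dF : ncderiv F x dF ->
  exists dP, ncderiv (fun y => logder (F y)) x dP.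
Proof.
move=> Fx; have H n : exists d, ncderiv (fun y => iter n (lderstep (F y)) 0) x d.
  elim: n => [|n [d IH]]; first by exists 0; exact: ncderiv_cst.
  eexists; apply: ncderivB; first exact: (ncderiv_wderiv Fx).
  apply: ncderivM IH _; apply: ncderivB Fx _; exact: ncderiv_cst.
have /choice[d dP] := H; exists (fun w => d (weight w).+1 w) => w.
exact: dP.
Qed.

(** With [P = logder F], differentiating [wderiv F = P * F] in two ways gives [wderiv A * F + A * P
    * F = P' * F + P * A * F], and [F] is cancelled on the right. *)
Lemma ncderiv_logder F x A : (\near x, F x [::] = 1) -> ncderiv F x (A * F x) ->
  ncderiv (fun y => logder (F y)) x (wderiv A + lie_bracket A (logder (F x))).
Proof.
move=> F1 Fx; have Fx1 := nbhs_singleton F1.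
have [dP HP] := ncderiv_logder_ex Fx.
suff -> : wderiv A + lie_bracket A (logder (F x)) = dP by [].
apply/esym/eqP; rewrite -subr_eq0; apply/eqP; apply: (nc_rcancel Fx1).
have : wderiv (A * F x) = dP * F x + logder (F x) * (A * F x).
  apply: (ncderiv_unique (F := fun y => wderiv (F y)) (x := x)).
    exact: ncderiv_wderiv.
  apply: ncderiv_near (ncderivM HP Fx).
  by apply: filterS F1 => y /logderE ->.
rewrite wderivM (logderE Fx1) /lie_bracket => E.
rewrite mulrBl mulrDl mulrBl -!mulrA; apply/eqP; rewrite subr_eq0 eq_sym.
by rewrite addrA E addrK.
Qed.

Lemma ncletters_linear (c : nat -> R[i]) : linear_letters (ncletters c).
Proof. by move=> [|j [|k w]]. Qed.

(** The strong induction on [n] covers all [x] at once, as the derivative at an inner point refers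
    to lower weights at that point. The functionals are constant by [clip_ae_const], and zero
    because [logder 1 = 0]. *)
Lemma lie_logder_solution T a F : 0 < T -> is_solution T a F ->
  forall n x, x \in `[0, T] -> lie_generated n (tcoef n (logder (F x))).
Proof.
move=> T0 [F1 F0 FL Fae]; elim/ltn_ind => n IH x xT.
have [N [s [A AP]]] := @lie_functionals R[i] n.
have FL' : nclip T F by move=> w; have [] := FL w; split; exact/rlipP.
apply/AP => j.
suff -> : \sum_i logder (F x) (s i) * A i j = \sum_i logder (F 0) (s i) * A i j.
  by rewrite F0 logder1 big1// => i _; rewrite mul0r.
apply: (clip_ae_const (T := T) (f := fun y => \sum_i logder (F y) (s i) * A i j)) xT.
  apply: clip_sum => i; apply: clipM; last exact: clip_cst.
  exact: (nclip_logder FL').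
apply: lebesgue_ae_imply Fae => y H yT; have {}H := H yT.
set a' := ncletters (a ^~ y) in H.
have yT' : y \in `[0, T] by move: yT; rewrite !in_itv /= => /andP[/ltW -> /ltW].
have HP : ncderiv (fun y => logder (F y)) y (wderiv a' + lie_bracket a' (logder (F y))).
  apply: ncderiv_logder => //.
  have : nbhs y `]0, T[%classic by apply: open_nbhs_nbhs; split.
  apply: filterS => z zT; apply: F1; move: zT => /=.
  by rewrite !in_itv /= => /andP[/ltW -> /ltW].
have /AP/(_ j) E : lie_generated n
    (tcoef n (wderiv a' + lie_bracket a' (logder (F y)))).
  have al := ncletters_linear (a ^~ y).
  rewrite tcoefD; apply: lie_generatedD.
    by apply: lie_tcoef_letters; exact: wderiv_letters.
  by apply: lie_tcoef_bracket_letters => // m mn; apply: IH.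
rewrite -[X in cderiv _ _ X]E; apply: cderiv_sum => i.
rewrite -[X in cderiv _ _ X]addr0 -[X in cderiv _ _ (_ + X)](mulr0 (logder (F y) (s i))).
by apply: cderivM; [exact: HP|exact: cderiv_cst].
Qed.

End ComplexDerivative.

(** * Piecewise constant paths *)

Section ConstantPaths.
Variable R : realType.
Implicit Types (f : ncseries R[i]) (x T tau h : R) (z : R -> R[i]).

Lemma cderivX z x r n : cderiv z x r ->
  cderiv (fun y => z y ^+ n) x (n%:R * z x ^+ n.-1 * r).
Proof.
move=> zr; elim: n => [|n IH].
  by rewrite !mul0r; under eq_fun do rewrite expr0; exact: cderiv_cst.
under eq_fun do rewrite exprS.
rewrite (_ : _ * r = r * z x ^+ n + z x * (n%:R * z x ^+ n.-1 * r)).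
  exact: cderivM.
by case: n {IH} => [|n] /=; rewrite -?natr1 ?exprS; ring.
Qed.

(** The right side is the termwise derivative of [exp (c f)] in [c]; the index shift rests on
    [k / k! = 1 / (k - 1)!]. *)
Lemma pexp_series_deriv f (c : R[i]) w : f [::] = 0 ->
  (f * pexp (c *: f)) w =
  \sum_(k < (size w).+1) expc _ k * (k%:R * c ^+ k.-1 * (f ^+ k) w).
Proof.
move=> f0; have cf0 : (c *: f) [::] = 0 by rewrite ncEZ f0 mulr0.
have -> : (f * pexp (c *: f)) w =
    (f * \sum_(k < (size w).+1) expc _ k *: (c *: f) ^+ k) w.
  rewrite !ncEM; apply: eq_bigr => k _; congr (_ * _).
  by apply: pserE => //; rewrite size_drop ltnS leq_subr.
rewrite mulr_sumr ncEsum big_ord_recr /= -scalerAr exprZn -scalerAr -exprS.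
rewrite [X in _ + X](_ : _ = 0) ?addr0; last first.
  by rewrite !ncEZ ncX_eq0// !mulr0.
rewrite [RHS]big_ord_recl !mul0r mulr0 add0r; apply: eq_bigr => k _.
rewrite -scalerAr exprZn -scalerAr -exprS !ncEZ /= mulrA.
rewrite !mulrA; congr (_ * _); congr (_ * _); rewrite /expc /bump /= add1n factS natrM invfM.
by rewrite mulrAC mulVf ?mul1r// pnatr_eq0.
Qed.

Lemma ncderiv_pexp f z x r : f [::] = 0 -> cderiv z x r ->
  ncderiv (fun y => pexp (z y *: f)) x ((r *: f) * pexp (z x *: f)).
Proof.
move=> f0 zr w; rewrite -scalerAl ncEZ pexp_series_deriv// mulr_sumr.
rewrite /pexp /pser.
apply: cderiv_sum => k; under eq_fun do rewrite exprZn ncEZ.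
rewrite (_ : r * _ = 0 * (z x ^+ k * (f ^+ k) w) +
    expc _ k * (k%:R * z x ^+ k.-1 * r * (f ^+ k) w + z x ^+ k * 0)); last by ring.
apply: cderivM; first exact: cderiv_cst.
by apply: cderivM; [exact: cderivX|exact: cderiv_cst].
Qed.

Lemma nclip_pexp f z T : clip T z -> nclip T (fun y => pexp (z y *: f)).
Proof.
move=> zT w; apply: clip_sum => k; apply: clipM; first exact: clip_cst.
under eq_fun do rewrite exprZn; apply: clipM; last exact: clip_cst.
elim: (k : nat) => [|n IH]; first exact: clip_cst.
by under eq_fun do rewrite exprS; exact: clipM.
Qed.

Lemma cderiv_affine tau (r : R[i]) x :
  cderiv (fun y => Complex (y - tau) 0 * r) x r.
Proof.
rewrite -[X in cderiv _ _ X]mul1r -[X in cderiv _ _ X]addr0.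
rewrite -[X in cderiv _ _ (_ + X)](mulr0 (Complex (x - tau) 0)).
apply: cderivM; last exact: cderiv_cst.
split => /=; last exact: is_derive_cst.
have H := is_deriveB (is_derive_id x (1 : R)) (is_derive_cst tau x (1 : R)).
by apply: (is_derive_eq H); rewrite subr0.
Qed.

Lemma clip_affine T (r : R[i]) : clip T (fun y => Complex y 0 * r).
Proof.
apply: clipM; last exact: clip_cst.
by split; [exists 1 => // x y _ _ /=; rewrite mul1r|exact: rlip_cst].
Qed.

(** Two points on either side of [tau] are compared through the common value [f tau = g 0]. *)
Lemma rlip_glue tau h (f g : R -> R) : 0 <= tau -> 0 <= h -> rlip tau f ->
  rlip h g -> f tau = g 0 ->
  rlip (tau + h) (fun x => if x < tau then f x else g (x - tau)).
Proof.
move=> t0 h0 [C C0 fC] [D D0 gD] fg; exists (C + D); first exact: addr_ge0.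
pose F x := if x < tau then f x else g (x - tau).
suff H x y : x \in `[0, tau + h] -> y \in `[0, tau + h] -> x <= y ->
    `|F x - F y| <= (C + D) * (y - x).
  move=> x y xT yT; have [xy|yx] := leP x y.
    by rewrite [X in _ * X]distrC [X in _ * X]ger0_norm ?subr_ge0//; exact: H.
  by rewrite distrC [X in _ * X]gtr0_norm ?subr_gt0//; apply: H; rewrite ?ltW.
rewrite !in_itv /= => /andP[x0 xT] /andP[y0 yT] xy; rewrite /F.
have [xt|tx] := ltP x tau; have [yt|ty] := ltP y tau.
- apply: le_trans (fC x y _ _) _; first by rewrite in_itv /= x0 ltW.
    by rewrite in_itv /= y0 ltW.
  rewrite distrC ger0_norm ?subr_ge0//; apply: ler_wpM2r; first by rewrite subr_ge0.
  by rewrite lerDl.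
- rewrite -(subrK (f tau) (f x)) -addrA; apply: le_trans (ler_normD _ _) _.
  rewrite {2}fg.
  apply: (@le_trans _ _ (C * (tau - x) + D * (y - tau))).
    apply: lerD.
      apply: le_trans (fC x tau _ _) _; first by rewrite in_itv /= x0 ltW.
        by rewrite in_itv /= t0 lexx.
      by rewrite distrC ger0_norm// subr_ge0 ltW.
    apply: le_trans (gD 0 (y - tau) _ _) _; first by rewrite in_itv /= lexx.
      by rewrite in_itv /= subr_ge0 ty lerBlDr addrC.
    by rewrite sub0r normrN ger0_norm// subr_ge0.
  rewrite mulrDl; apply: lerD; apply: ler_wpM2l => //; lra.
- by move: (le_lt_trans tx (le_lt_trans xy yt)); rewrite ltxx.
- apply: le_trans (gD (x - tau) (y - tau) _ _) _.
  + by rewrite in_itv /= subr_ge0 tx lerBlDr addrC.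
  + by rewrite in_itv /= subr_ge0 ty lerBlDr addrC.
  rewrite opprB addrA subrK distrC ger0_norm ?subr_ge0//.
  apply: ler_wpM2r; first by rewrite subr_ge0.
  by rewrite lerDr.
Qed.

(** A strengthening of [paths] and [is_solution] that is easy to preserve under concatenation:
    coefficients measurable and bounded on the whole line, and finitely many exceptional points. *)
Definition tame_solution T (a : nat -> R -> R[i]) (F : R -> ncseries R[i]) :=
  [/\ forall j, measurable_fun setT (fun x => complex.Re (a j x)) /\
                measurable_fun setT (fun x => complex.Im (a j x)),
      exists C : R, forall j x, Normc.normc (a j x) <= C,
      forall x, F x [::] = 1,
      F 0 = 1 &
      nclip T F /\ exists E : seq R, forall x, x \in `]0, T[ -> x \notin E ->
        ncderiv F x (ncletters (a ^~ x) * F x)].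

Lemma normc_ge0 (c : R[i]) : 0 <= Normc.normc c.
Proof. by case: c => x y; exact: sqrtr_ge0. Qed.

Lemma tame_paths T a F : tame_solution T a F -> paths T a.
Proof.
move=> [am [C aC] _ _ _].
have mI : measurable (`[0, T] : set R) by exact: measurable_itv.
split=> [j|].
  split; first by apply: measurable_funTS; exact: (am j).1.
    by apply: measurable_funTS; exact: (am j).2.
  by exists C; apply: aeW => x _; exact: aC.
(* A bound of at least [1] only decreases when a root is taken. *)
exists (Num.max 1 C) => j; apply: aeW => x _.
have M1 : 1 <= Num.max 1 C by rewrite le_max lexx.
have M0 : 0 <= Num.max 1 C by apply: le_trans M1.
apply: (@le_trans _ _ (Num.max 1 C `^ j.+1%:R^-1)).
  apply: ge0_ler_powR; rewrite ?nnegrE ?normc_ge0 ?invr_ge0//.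
  by rewrite le_max aC orbT.
rewrite -{2}[Num.max 1 C]powRr1//; apply: ler_powR => //.
by rewrite invf_le1 ?ltr0n// ler1n.
Qed.

Lemma tame_is_solution T a F : tame_solution T a F -> is_solution T a F.
Proof.
move=> [_ _ F1 F0 [FL [E FE]]]; split=> // [x _|w|].
- exact: F1.
- by have [FLr FLi] := FL w; split; exact/rlipP.
have Ec : countable [set` E] by exact/finite_set_countable/finite_seq.
exists [set` E]; split.
- by apply: countable_measurable => // t; exact: measurable_set1.
- exact: countable_lebesgue_measure0.
move=> x /= nx; apply: contrapT => /negP xE; apply: nx => xT w.
by have := FE x xT xE w; case.
Qed.

Lemma tame_solution0 : exists a F, tame_solution 0 a F /\ F 0 = 1.
Proof.
exists (fun _ _ => 0), (fun=> 1); split=> //; split=> //.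
- by exists 0 => j x; rewrite /= expr0n /= addr0 sqrtr0.
- split; first exact: nclip_cst.
  exists [::] => x; rewrite in_itv /= => /andP[x0 x1] _.
  by move: (lt_trans x0 x1); rewrite ltxx.
Qed.

(** On the added interval a single letter is active, with constant coefficient. Since the equation
    is [F' = A F], its exponential multiplies the earlier endpoint on the left. *)
Lemma tame_solution_extend tau h (c : R[i]) j a F : 0 <= tau -> 0 < h ->
  tame_solution tau a F -> exists a' F', tame_solution (tau + h) a' F' /\
    F' (tau + h) = pexp (c *: ncvar _ j) * F tau.
Proof.
move=> t0 h0 [am [C aC] F1 F0 [FL [E FE]]].
(* The speed [c / h], which accumulates to [c] over the time [h]. *)
pose r : R[i] := Complex h^-1 0 * c.
pose a' k x := if x < tau then a k x else if k == j then r else 0.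
pose G y := pexp ((Complex y 0 * r) *: ncvar R[i] j) * F tau.
pose F' x := if x < tau then F x else G (x - tau).
have v0 : ncvar R[i] j [::] = 0 by [].
have G0 : G 0 = F tau.
  by rewrite /G (_ : Complex 0 0 = 0)// mul0r scale0r pexp0 mul1r.
exists a', F'; split; last first.
  have hr : Complex h 0 * r = c.
    rewrite /r mulrA (_ : Complex h 0 * Complex h^-1 0 = 1) ?mul1r//.
    by apply: complex_ext; rewrite ?ReM ?ImM /= ?mulr0 ?mul0r ?subr0 ?addr0 ?divff ?gt_eqF.
  have -> : F' (tau + h) = G h.
    rewrite /F' (_ : tau + h < tau = false); last by rewrite ltNge lerDl (ltW h0).
    by congr (G _); rewrite addrC addKr.
  by rewrite /G hr.
split.
- have mlt : measurable_fun setT (fun x : R => x < tau).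
    by apply: measurable_realfun.measurable_fun_ltr => //; exact: measurable_id.
  move=> k; split.
    rewrite (_ : (fun x => _) = fun x => if x < tau then complex.Re (a k x)
        else complex.Re (if k == j then r else 0)).
      by apply: measurable_fun_ifT => //; exact: (am k).1.
    by apply/funext => x; rewrite /a'; case: ifP.
  rewrite (_ : (fun x => _) = fun x => if x < tau then complex.Im (a k x)
      else complex.Im (if k == j then r else 0)).
    by apply: measurable_fun_ifT => //; exact: (am k).2.
  by apply/funext => x; rewrite /a'; case: ifP.
- exists (C + Normc.normc r) => k x; rewrite /a'.
  have C0 : 0 <= C by apply: le_trans (aC 0%N 0); exact: normc_ge0.
  case: ifP => _; first by rewrite (le_trans (aC _ _))// lerDl normc_ge0.
  case: ifP => _; first by rewrite lerDr.
  by rewrite /= expr0n /= addr0 sqrtr0 addr_ge0// normc_ge0.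
- by move=> x; rewrite /F' /G; case: ifP => _ //; rewrite ncEMnil pexp_nil F1 mulr1.
(* When [tau = 0] the point [0] already belongs to the new piece. *)
- rewrite /F'; case: ltP => // t0'; have tE : tau = 0 by apply/eqP; rewrite eq_le t0 t0'.
  have -> : 0 - tau = 0 by rewrite tE subrr.
  by rewrite G0 tE F0.
split.
  move=> w; have [FLr FLi] := FL w.
  have GL : nclip h G.
    apply: nclipM; last exact: nclip_cst.
    by apply: nclip_pexp; exact: clip_affine.
  have [GLr GLi] := GL w; split.
    rewrite (_ : (fun y => _) = fun y => if y < tau then complex.Re (F y w)
        else complex.Re (G (y - tau) w)).
      by apply: (rlip_glue t0 (ltW h0) FLr GLr); rewrite G0.
    by apply/funext => y; rewrite /F'; case: ifP.
  rewrite (_ : (fun y => _) = fun y => if y < tau then complex.Im (F y w)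
      else complex.Im (G (y - tau) w)).
    by apply: (rlip_glue t0 (ltW h0) FLi GLi); rewrite G0.
  by apply/funext => y; rewrite /F'; case: ifP.
(* The solution may have a corner at the junction [tau]. *)
exists (tau :: E) => x; rewrite in_itv /= => /andP[x0 xT].
rewrite inE negb_or => /andP[xt xE].
have [xlt|] := ltP x tau.
  have xn : \near x, x < tau by exact: lt_nbhsl.
  have -> : a' ^~ x = a ^~ x by apply/funext => k; rewrite /a' xlt.
  rewrite {2}/F' xlt; apply: (@ncderiv_near _ F).
    by apply: filterS xn => y yt; rewrite /F' yt.
  by apply: FE => //; rewrite in_itv /= x0.
rewrite le_eqVlt eq_sym (negPf xt) /= => tx.
have xn : \near x, tau < x by exact: lt_nbhsr.
have nlt y : tau < y -> (y < tau) = false by move=> ty; rewrite ltNge ltW.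
have -> : ncletters (a' ^~ x) = r *: ncvar _ j.
  apply: ncext => w; rewrite ncEZ /ncvar.
  case: w => [|k [|l w]]; [by rewrite mulr0| |by rewrite [_ == _]andbF mulr0].
  rewrite /ncletters /a' nlt//.
  by rewrite -[[:: k] == _]/((k == j) && true) andbT; case: eqP; rewrite ?mulr1 ?mulr0.
apply: (@ncderiv_near _ (fun y => pexp ((Complex (y - tau) 0 * r) *: ncvar _ j) * F tau)).
  by apply: filterS xn => y yt; rewrite /F' nlt.
rewrite /F' nlt// /G mulrA -[X in ncderiv _ _ X]addr0.
rewrite -[X in ncderiv _ _ (_ + X)](mulr0 (pexp ((Complex (x - tau) 0 * r) *: ncvar _ j))).
apply: ncderivM; last exact: ncderiv_cst.
by apply: ncderiv_pexp => //; exact: cderiv_affine.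
Qed.

Definition letter_products : set (ncseries R[i]) :=
  [set g | exists s : seq (R[i] * nat), g = \prod_(p <- s) pexp (p.1 *: ncvar _ p.2)].

(** Later pieces multiply on the left, so the head of [s] is the last piece of the path and
    induction on [s] extends the path at its end. *)
Lemma tame_solution_product h (s : seq (R[i] * nat)) : 0 < h ->
  exists a F, tame_solution (h *+ size s) a F /\
    F (h *+ size s) = \prod_(p <- s) pexp (p.1 *: ncvar _ p.2).
Proof.
move=> h0; elim: s => [|[c j] s [a [F [aF FE]]]].
  by rewrite big_nil mulr0n; exact: tame_solution0.
rewrite big_cons -FE /= mulrSr; apply: tame_solution_extend aF => //.
by rewrite mulrn_wge0// ltW.
Qed.

Lemma letter_products_paths T : 0 < T -> letter_products `<=` group_of_paths T.
Proof.
(* The added trivial factor keeps the number of pieces positive, so that [T] can be divided among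
   them. *)
move=> T0 g [s gE]; pose s' := (0 : R[i], 0%N) :: s.
have h0 : 0 < T / (size s')%:R by rewrite divr_gt0.
have [a [F [aF FE]]] := tame_solution_product s' h0.
have TE : T / (size s')%:R *+ size s' = T by rewrite -mulr_natr divfK// pnatr_eq0.
rewrite TE in aF FE; exists a, F; split.
- exact: tame_paths aF.
- exact: tame_is_solution aF.
- by rewrite FE big_cons scale0r pexp0 mul1r -gE.
Qed.

Lemma letter_products1 : letter_products 1.
Proof. by exists [::]; rewrite big_nil. Qed.

Lemma letter_productsM f g : letter_products f -> letter_products g ->
  letter_products (f * g).
Proof. by move=> [s ->] [t ->]; exists (s ++ t); rewrite big_cat. Qed.

Lemma letter_products_var (c : R[i]) j : letter_products (pexp (c *: ncvar _ j)).
Proof. by exists [:: (c, j)]; rewrite big_seq1. Qed.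

End ConstantPaths.

(** * Recovering Lie elements from logarithmic derivatives *)

Section LogderExp.
Variable K : numFieldType.
Implicit Types f : ncseries K.

(** By [pexpB_agree] and [logder_agree], neither [exp f - f] nor [logder g - wderiv g] changes at
    weight [n], and [wderiv] multiplies by [n] there. *)
Lemma logder_pexpB n f f' w : f [::] = 0 -> f' [::] = 0 -> agree n f f' ->
  weight w = n ->
  logder (pexp f) w - logder (pexp f') w = n%:R * (f w - f' w).
Proof.
move=> f0 f0' ff' wn; have wn' : (weight w < n.+1)%N by rewrite wn.
have gg' := pser_congr (expc K) ff'.
have E1 : pexp f w - f w = pexp f' w - f' w := pexpB_agree f0 f0' ff' wn'.
have E2 : logder (pexp f) w - (weight w)%:R * pexp f w =
    logder (pexp f') w - (weight w)%:R * pexp f' w.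
  exact: (logder_agree (pexp_nil f) (pexp_nil f') gg' wn').
rewrite wn in E2; move: E1 E2.
move: (logder _ w) (logder _ w) (pexp f w) (pexp f' w) => l' l e e' E1 E2.
have -> : l = l' - n%:R * e' + n%:R * e by rewrite -E2 subrK.
have -> : e = e' - f' w + f w by rewrite -E1 subrK.
by ring.
Qed.

Lemma tcoef_logder_pexp n f f' : (0 < n)%N -> f [::] = 0 -> f' [::] = 0 ->
  agree n f f' -> (forall w, weight w = n -> f' w = 0) ->
  tcoef n f = n%:R^-1 *:
    (-1 *: tcoef n (logder (pexp f')) + tcoef n (logder (pexp f))).
Proof.
move=> n0 f0 f0' ff' f'0; apply: ncext => w; rewrite ncEZ ncED ncEZ /tcoef.
case: eqP => [wn|_]; last by rewrite mulr0 addr0 mulr0.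
rewrite mulN1r addrC (logder_pexpB f0 f0' ff' wn) f'0// subr0 mulKf//.
by rewrite pnatr_eq0 -lt0n.
Qed.

End LogderExp.

Section LieCharacterization.
Variable R : realType.
Local Notation K := (R[i]).
Implicit Types (f g : ncseries R[i]) (T : R).

Lemma wderiv_cvg (U : Type) (F : set_system U) {FF : Filter F}
    (u : U -> ncseries K) f : u @ F --> f -> (fun i => wderiv (u i)) @ F --> wderiv f.
Proof.
move=> /nc_cvgP uf; apply/nc_cvgP => w.
by apply: (@cvgM K); [exact: cvg_cst|exact: uf].
Qed.

Lemma logder_continuous : continuous (@logder K).
Proof.
apply: ncfix_continuous => g n; have FF := nbhs_filter g.
elim: n => [|n IH]; first exact: cvg_cst.
apply: nc_cvgD; first exact: (@wderiv_cvg _ (nbhs g) _ id).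
apply: nc_cvgN; apply: nc_cvgM => //.
by apply: (@nc_cvgD _ _ (nbhs g) _ id) => //; exact: cvg_cst.
Qed.

(** By [lie_functionals], an intersection of zero sets of continuous functions. *)
Lemma closed_logder_lie n : closed [set g | lie_generated n (tcoef n (@logder K g))].
Proof.
have [N [s [A AP]]] := @lie_functionals K n.
pose lam j g : K^o := \sum_i logder g (s i) * A i j.
rewrite (_ : mkset _ = \bigcap_(j in setT) (lam j @^-1` [set 0])); last first.
  by apply/seteqP; split=> g /= => [/AP H j _|H]; [exact: H|apply/AP => j; exact: H].
apply: closed_bigI => j _; apply: preimage_closed => [g _|].
  have FF := nbhs_filter g; apply: (@fctsum_cvg K) => i; apply: (@cvgM K); last exact: cvg_cst.
  exact: ((nc_cvgP (@logder K) (logder g)).1 (@logder_continuous g) (s i)).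
exact/accessible_closed_set1/hausdorff_accessible/norm_hausdorff.
Qed.

Lemma closure_paths_lie T g n : 0 < T -> closure (group_of_paths T) g ->
  lie_generated n (tcoef n (logder g)).
Proof.
move=> T0; rewrite closureE => /(_ _ (conj (@closed_logder_lie n) _)); apply.
move=> _ [a [F [_ aF <-]]] /=; apply: (lie_logder_solution T0 aF).
by rewrite in_itv /= lexx ltW.
Qed.

Lemma lie_elements_closure_paths T f : 0 < T -> lie_elements f ->
  closure (group_of_paths T) (pexp f).
Proof.
move=> T0 lf; apply: (closureS (letter_products_paths T0)).
apply: pexp_lie_closure lf.
- exact: natr_inv_cvg.
- exact: letter_products1.
- exact: letter_productsM.
- exact: letter_products_var.
Qed.

Lemma lie_elements_logder f : f [::] = 0 ->
  (forall n, lie_generated n (tcoef n (logder (pexp f)))) -> lie_elements f.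
Proof.
move=> f0 H; split=> // n; elim/ltn_ind: n => n IH n0.
pose f' : ncseries K := fun w => if (weight w < n)%N then f w else 0.
have ff' : agree n f f' by move=> w wn; rewrite /f' wn.
have f0' : f' [::] = 0 by rewrite /f' weight_nil n0.
have lf' : lie_elements f'.
  split=> // m m0; have [mn|nm] := ltnP m n.
    rewrite (_ : tcoef m f' = tcoef m f); first exact: IH.
    by apply: ncext => w; rewrite /tcoef /f'; case: eqP => // ->; rewrite mn.
  rewrite (_ : tcoef m f' = 0); first exact: lie_generated0.
  by apply: ncext => w; rewrite /tcoef /f'; case: eqP => // ->; rewrite ltnNge nm.
have H' : lie_generated n (tcoef n (logder (pexp f'))).
  (* The claim about [f'] does not mention paths, so an interval of any positive length serves, here
     [1]. *)
  exact: (@closure_paths_lie 1 _ n ltr01 (lie_elements_closure_paths ltr01 lf')).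
rewrite (tcoef_logder_pexp n0 f0 f0' ff') => [|w wn]; last by rewrite /f' wn ltnn.
exact: (lie_generatedZ _ (lie_generated_lin _ H' (H n))).
Qed.

End LieCharacterization.

Theorem theorem2p10 (R : realType) (T : R) (hT : 0 < T) :
  maps_homeomorphically (@ncexp R[i]) (@lie_elements R[i])
    (group_of_formal_paths T).
Proof.
have expE (f : ncseries R[i]) : lie_elements f -> ncexp f = pexp f.
  by move=> [f0 _]; exact: ncexpE.
split.
- split=> [f lf|f f' /set_mem lf /set_mem lf'|g [g1 gc]].
  + rewrite expE//; split; first exact: pexp_nil.
    exact: lie_elements_closure_paths.
  + rewrite (expE f lf) (expE f' lf') => E; exact: pexp_inj lf.1 lf'.1 E.
  (* The preimage of [g] is its logarithm; the Lie condition is read off from the logarithmic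
     derivative of [g] itself. *)
  + have lg : lie_elements (nclog g).
      apply: lie_elements_logder => [|n]; first exact: nclog_nil.
      by rewrite nclogK//; exact: closure_paths_lie gc.
    by exists (nclog g) => //; rewrite (expE _ lg); exact: nclogK.
(* [ncexp] is known to equal [pexp] only without constant term, so continuity is transferred within
   the subspace of Lie elements. *)
- apply: (@subspace_eq_continuous _ _ _ (@pexp R[i])).
    by move=> f /set_mem lf; exact/esym/expE.
  by apply: continuous_subspaceT; exact: pexp_continuous.
- exists (@nclog R[i]); split=> [f lf|].
    by rewrite (expE f lf); exact: pexpK lf.1.
  by apply: continuous_subspaceT; exact: nclog_continuous.
Qed.
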